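(* Let $G$ be a finite group, let $V$ be a finite-dimensional representation of $G$ over $\mathbb{Q}$, and let $G$ act diagonally on the (rational) tensor algebra $TV$. Let $R\subseteq V\otimes V$ be a submodule and suppose $A:=TV/\langle R\rangle$ is a Koszul algebra. Then $A$ is a graded representation of $G$ whose character satisfies, for every $\sigma\in G$, the ''Koszul'' formula $$A_\sigma(z)\,A^!_\sigma(-z)=1,$$ where $A_\sigma(z)=\sum_{i\ge0}\mathrm{tr}(\sigma|_{A^i})z^i$ is the graded character of the representation $A$ evaluated at $\sigma$, and similarly $A^!_\sigma(z)$ is the graded character of the quadratic dual $A^!$ evaluated at $\sigma$.
   Context: $\langle R\rangle$ is the two-sided ideal of $TV$ generated by $R$; $A$ is graded by tensor degree, with degree-$i$ component $A^i$. The quadratic dual is $A^!:=TV^*/\langle R^\perp\rangle$, where $R^\perp\subseteq V^*\otimes V^*$ is the annihilator of $R$, with $G$ acting on $V^*$ by the dual representation. Koszulness: for $n\ge2$ and $1\le i\le n-1$ put $X^n_i=V^{\otimes i-1}\otimes R\otimes V^{\otimes n-1-i}\subseteq V^{\otimes n}$. Writing $U/W$ for $U/(U\cap W)$, the degree-$n$ part of the Koszul complex is the sequence with terms $E_i=\dfrac{X^n_i\cap\dots\cap X^n_{n-1}}{X^n_1+\dots+X^n_{i-2}}$, for $i=1,\dots,n+1$ (an empty intersection is $V^{\otimes n}$, an empty sum is $0$, so it starts $0\to X^n_1\cap\dots\cap X^n_{n-1}\to X^n_2\cap\dots\cap X^n_{n-1}\to\cdots$ and ends $\cdots\to V^{\otimes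 n}/(X^n_1+\dots+X^n_{n-2})\to V^{\otimes n}/(X^n_1+\dots+X^n_{n-1})\to0$), with differential $d_i:E_i\to E_{i+1}$ the composite of the obvious inclusion $\frac{X^n_i\cap\dots\cap X^n_{n-1}}{X^n_1+\dots+X^n_{i-2}}\hookrightarrow\frac{X^n_{i+1}\cap\dots\cap X^n_{n-1}}{X^n_1+\dots+X^n_{i-2}}$ and projection onto $\frac{X^n_{i+1}\cap\dots\cap X^n_{n-1}}{X^n_1+\dots+X^n_{i-1}}$. $A$ is Koszul if this complex is exact for all $n\ge2$. *)

(* Defs.v *)
From mathcomp Require Import all_boot all_order all_algebra all_fingroup.
From mathcomp Require Import mxrepresentation.
From mathcomp Require Import finmap boolp classical_sets.
From mathcomp.multinomials Require Export monalg.

Set Implicit Arguments.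
Unset Strict Implicit.
Unset Printing Implicit Defensive.

Import GRing.Theory.

Local Open Scope classical_set_scope.
Local Open Scope ring_scope.

Section Linear.
Variables (F : fieldType) (L : lmodType F).
Implicit Types (S U W : set L).

Definition subspace U : Prop :=
  U 0 /\ forall (a : F) x y, U x -> U y -> U (a *: x + y).

Definition lspan S : set L := smallest subspace S.

(* [b] induces a basis of the quotient U/(U `&` W). *)
Definition basis_mod U W (k : nat) (b : 'I_k -> L) : Prop :=
  [/\ forall i, U (b i),
      forall x, U x -> exists c : 'I_k -> F, W (x - \sum_i c i *: b i)
    & forall c : 'I_k -> F, W (\sum_i c i *: b i) -> forall i, c i = 0].

(* The trace of the endomorphism of the finite-dimensional space U/(U `&` W)
   induced by f, for f linear and mapping U to U and U `&` W to W; [quo_traceE]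
   shows that it does not depend on the basis. *)
Definition quo_trace (f : L -> L) U W : F :=
  xget 0 [set t | exists k (b : 'I_k -> L) (M : 'M[F]_k),
    [/\ basis_mod U W b,
        forall j, W (f (b j) - \sum_i M i j *: b i)
      & t = \tr M]].

Lemma subspace_sum U (I : Type) (r : seq I) (c : I -> F) (y : I -> L) :
  subspace U -> (forall i, U (y i)) -> U (\sum_(i <- r) c i *: y i).
Proof.
move=> [U0 UL] Uy; elim: r => [|i r IHr]; first by rewrite big_nil.
by rewrite big_cons; apply: UL.
Qed.

Lemma subspaceB U x y : subspace U -> U x -> U y -> U (x - y).
Proof.
by move=> [U0 UL] Ux Uy; rewrite addrC -scaleN1r; apply: UL.
Qed.

Lemma subspaceD U x y : subspace U -> U x -> U y -> U (x + y).
Proof. by move=> [U0 UL] Ux Uy; rewrite -[x]scale1r; apply: UL. Qed.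

Section QuotientTrace.
Variables U W : set L.
Hypotheses (sU : subspace U) (sW : subspace W).

Definition colcomb k m (b : 'I_k -> L) (A : 'M[F]_(k, m)) (j : 'I_m) : L :=
  \sum_i A i j *: b i.

Lemma colcomb_trans k m n (b : 'I_k -> L) (y : 'I_m -> L) z
    (A : 'M[F]_(k, m)) (B : 'M[F]_(m, n)) (j : 'I_n) :
  W (z - colcomb y B j) -> (forall i, W (y i - colcomb b A i)) ->
  W (z - colcomb b (A *m B) j).
Proof.
move=> Wz Wy.
have -> : z - colcomb b (A *m B) j =
    (z - colcomb y B j) + \sum_i B i j *: (y i - colcomb b A i).
  under eq_bigr do rewrite scalerBr.
  rewrite sumrB addrA subrK; congr (_ - _); rewrite /colcomb.
  under [RHS]eq_bigr do rewrite scaler_sumr.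
  rewrite exchange_big; apply: eq_bigr => l _.
  rewrite mxE scaler_suml; apply: eq_bigr => i _.
  by rewrite scalerA mulrC.
by apply: subspaceD => //; apply: subspace_sum.
Qed.

Lemma colcomb_inj k m (b : 'I_k -> L) (z : 'I_m -> L) (A B : 'M[F]_(k, m)) :
  basis_mod U W b -> (forall j, W (z j - colcomb b A j)) ->
  (forall j, W (z j - colcomb b B j)) -> A = B.
Proof.
move=> [_ _ fb] WA WB; apply/matrixP=> i j; apply/eqP; rewrite -subr_eq0.
apply/eqP; apply: (fb (fun l => A l j - B l j)).
under eq_bigr do rewrite scalerBl.
rewrite sumrB -/(colcomb b A j) -/(colcomb b B j).
have -> : colcomb b A j - colcomb b B j =
    (z j - colcomb b B j) - (z j - colcomb b A j).
  by rewrite opprB [RHS]addrC addrA subrK.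
exact: subspaceB.
Qed.

Lemma colcomb_ex k m (b : 'I_k -> L) (z : 'I_m -> L) :
  basis_mod U W b -> (forall j, U (z j)) ->
  exists A : 'M[F]_(k, m), forall j, W (z j - colcomb b A j).
Proof.
move=> [_ gb _] Uz; have /choice[c cP] := fun j => gb _ (Uz j).
exists (\matrix_(i, j) c j i) => j; rewrite /colcomb.
by under eq_bigr do rewrite mxE.
Qed.

Lemma colcomb1 k (b : 'I_k -> L) j : W (b j - colcomb b 1%:M j).
Proof.
rewrite /colcomb (bigD1 j) //= big1 => [|i /negPf ne_ij]; last first.
  by rewrite mxE ne_ij scale0r.
by rewrite mxE eqxx scale1r addr0 subrr; case: sW.
Qed.

Lemma quo_traceE (f : L -> L) k (b : 'I_k -> L) (M : 'M[F]_k) :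
  linear f -> (forall x, U x -> W x -> W (f x)) -> basis_mod U W b ->
  (forall j, W (f (b j) - \sum_i M i j *: b i)) -> quo_trace f U W = \tr M.
Proof.
move=> fL fW bP MP; apply: xget_unique; first by exists k, b, M.
move=> _ [k' [b' [M' [b'P M'P ->]]]].
have [Ub _ _] := bP; have [Ub' _ _] := b'P.
have [P PP] := colcomb_ex bP Ub'; have [Q QP] := colcomb_ex b'P Ub.
have PQ1 : P *m Q = 1%:M.
  apply: (colcomb_inj bP (z := b)) (colcomb1 b) => j.
  exact: colcomb_trans (QP j) PP.
have QP1 : Q *m P = 1%:M.
  apply: (colcomb_inj b'P (z := b')) (colcomb1 b') => j.
  exact: colcomb_trans (PP j) QP.
have f0 : f 0 = 0.
  by have := fL (-1) 0 0; rewrite scaler0 addr0 scaleN1r addNr.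
have fsum m (c : 'I_m -> F) (y : 'I_m -> L) :
    f (\sum_i c i *: y i) = \sum_i c i *: f (y i).
  apply: (big_rec2 (fun u v => f u = v)) => // i u v _ <-; exact: fL.
have fB x y : f (x - y) = f x - f y.
  by rewrite addrC -scaleN1r fL scaleN1r addrC.
have PM' : P *m M' = M *m P.
  apply: (colcomb_inj bP (z := f \o b')) => j.
    exact: colcomb_trans (M'P j) PP.
  apply: (colcomb_trans (y := f \o b)) => //=.
  have -> : colcomb (f \o b) P j = f (colcomb b P j) by rewrite fsum.
  rewrite -fB; apply: fW; last exact: PP.
  by apply: subspaceB => //; apply: subspace_sum.
by rewrite -[M']mul1mx -QP1 -mulmxA PM' mxtrace_mulC -mulmxA PQ1 mulmx1.
Qed.

End QuotientTrace.

(* Exactness in the middle of U1/W1 -> U2/W2 -> U3/W3, where U1 `<=` U2 `<=` U3,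
   both maps are induced by the identity, and U/W means U/(U `&` W): a class in
   the middle maps to zero iff it is the class of an element of U1. *)
Definition subquo_exact U1 U2 W2 W3 : Prop :=
  forall x, U2 x -> (W3 x <-> exists2 y, U1 y & W2 (x - y)).

End Linear.

Section TensorAlgebra.
Variable d : nat.

(* The tensor algebra of a rational vector space V with basis e_0, ..., e_(d-1),
   as the free algebra on the e_i: the monomial [:: i_1; ...; i_n] stands for
   e_(i_1) (x) ... (x) e_(i_n). *)
Definition TV := {malg rat[{fmonom 'I_d}]}.

Implicit Types (R : set TV).

Definition tpow (n : nat) : set TV :=
  lspan [set x | exists2 m : {fmonom 'I_d}, fdeg m = n & x = << m >>].

Definition two_sided_ideal (I : set TV) : Prop :=
  subspace I /\ forall a x, I x -> I (a * x) /\ I (x * a).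

Definition ideal_gen R : set TV := smallest two_sided_ideal R.

(* The diagonal action on TV of the endomorphism of V with matrix M acting on
   column vectors, that is, e_j |-> \sum_i M i j e_i. *)
Definition tact (M : 'M[rat]_d) : TV -> TV :=
  mmap (fun c : rat => c%:MP)
       (fun m : {fmonom 'I_d} =>
          \prod_(j <- (m : seq 'I_d)) \sum_i << M i j *g fmu i >>).

Definition tpairing (f x : TV) : rat := \sum_(m <- msupp f) f@_m * x@_m.

(* The annihilator of R in V^* (x) V^*; elements of T(V^* ) are written in the
   basis dual to (e_i). *)
Definition annihilator R : set TV :=
  [set f | tpow 2 f /\ forall x, R x -> tpairing f x = 0].

(* The (i-1)-st tensor power of V, tensor R, tensor the (n-1-i)-th
   one, for 1 <= i <= n-1. *)
Definition koszul_X R (n i : nat) : set TV :=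
  lspan [set x | exists u r v,
    [/\ tpow (i - 1) u, R r, tpow (n - 1 - i) v & x = u * r * v]].

(* Numerator and denominator of the i-th term E_i of the degree-n part of the
   Koszul complex; E_0 = 0/0 and E_(n+2) = tpow n/tpow n are the zero spaces
   at both ends. *)
Definition koszul_num R (n i : nat) : set TV :=
  if i == 0%N then [set 0]
  else tpow n `&` \bigcap_(j in [set j | (i <= j < n)%N]) koszul_X R n j.

Definition koszul_den R (n i : nat) : set TV :=
  if (i <= n.+1)%N
  then lspan (\bigcup_(j in [set j | (1 <= j <= i - 2)%N]) koszul_X R n j)
  else tpow n.

Definition koszul R : Prop :=
  forall n i, (2 <= n)%N -> (1 <= i <= n.+1)%N ->
  subquo_exact (koszul_num R n i.-1) (koszul_num R n i)
               (koszul_den R n i) (koszul_den R n i.+1).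

End TensorAlgebra.

Arguments tpow d n _ : clear implicits.

Section Representation.
Variables (gT : finGroupType) (G : {group gT}) (d : nat).
Variable rV : mx_representation rat G d.

Lemma dual_mx_repr : mx_repr G (fun g => (rV (g^-1)%g)^T).
Proof.
split=> [|g h Gg Gh]; first by rewrite invg1 repr_mx1 trmx1.
by rewrite invMg repr_mxM ?groupV // trmx_mul.
Qed.

(* g acts on V^* by f |-> f \o g^-1, written in the dual basis. *)
Definition dual_repr := MxRepresentation dual_mx_repr.

Definition submodule2 (R : set (TV d)) : Prop :=
  [/\ subspace R, R `<=` tpow d 2
    & forall g x, g \in G -> R x -> R (tact (rV g) x)].

(* The diagonal action on TV makes each degree-n component
   tpow n/(tpow n `&` <R>) of A = TV/<R> a (left) representation of G. *)
Definition graded_repr (R : set (TV d)) : Prop :=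
  forall n, [/\
    forall g, g \in G ->
      [/\ linear (tact (rV g)),
          forall x, tpow d n x -> tpow d n (tact (rV g) x)
        & forall x, tpow d n x -> ideal_gen R x ->
            ideal_gen R (tact (rV g) x)],
    forall x, tpow d n x -> ideal_gen R (tact (rV 1%g) x - x)
  & forall g h x, g \in G -> h \in G -> tpow d n x ->
      ideal_gen R (tact (rV (g * h)%g) x - tact (rV g) (tact (rV h) x))].

Definition graded_char (R : set (TV d)) (g : gT) (n : nat) : rat :=
  quo_trace (tact (rV g)) (tpow d n) (ideal_gen R).

End Representation.

(* Formal power series over rat, as coefficient sequences. *)
Definition series_mul (a b : nat -> rat) (n : nat) : rat :=
  \sum_(i < n.+1) a i * b (n - i)%N.

Definition series_opp_var (a : nat -> rat) (n : nat) : rat := (-1) ^+ n * a n.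

Definition series_one (n : nat) : rat := (n == 0%N)%:R.

(* Main.v *)
Require Import Defs.
From mathcomp Require Import all_boot all_order all_algebra all_fingroup.
From mathcomp Require Import mxrepresentation algC classfun character.
From mathcomp Require Import finmap boolp classical_sets.
From mathcomp Require Import zify.

(* Degree n of the Koszul complex is an exact sequence of representations whose
   (p+1)-st term is A^p tensor K_(n-p), where K_m is the intersection of all the
   X^m_j: slicing tensors by words in the basis of V identifies its numerator
   with V^p tensor K_(n-p) and its denominator with <R>_p tensor V^(n-p).  Taking
   alternating traces of s gives sum_p (-1)^p tr(s|A^p) tr(s|K_(n-p)) = 0 for
   n >= 1.  The annihilator of K_m is the degree-m part of <R^perp>, so K_m is
   dual to the degree-m part of A^!, on which s therefore has the trace of s^-1
   on K_m.  Since the base field is rat, this equals tr(s|K_m). *)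

Set Implicit Arguments.
Unset Strict Implicit.
Unset Printing Implicit Defensive.

Import GRing.Theory.

Local Open Scope classical_set_scope.
Local Open Scope ring_scope.

(** * Traces on subquotients *)

Section LinearAlgebra.
Variables (F : fieldType) (L : lmodType F).
Implicit Types (U W Z T : set L) (f : L -> L).

(** Quotients are never formed: every term is a pair of subspaces of the one space [TV], and
    [quo_trace] chooses a basis of U modulo W. A trace identity is therefore proved by exhibiting
    bases and matrices, and finiteness comes from the words of length n spanning [tpow d n]. The
    obstacle is a basis of a Koszul term, whose numerator is an intersection of spans and whose
    denominator is a sum of spans. What helps is position: for the (p+1)-st term the numerator
    constrains only the last n-p letters, while the denominator puts R within the first p.
    Contracting with words on the left, respectively on the right, turns both memberships into
    conditions on slices. The inverse in the trace on the dual side arises because g acts on V^* by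
    the transpose of g^-1, and transposition of matrices is adjunction for the pairing in which
    words are orthonormal. *)

Lemma linear_fun0 (V : lmodType F) (f : L -> V) : linear f -> f 0 = 0.
Proof.
by move=> fL; have := fL (-1) 0 0; rewrite scaler0 addr0 scaleN1r addNr.
Qed.

Lemma linear_fun_sum (V : lmodType F) (f : L -> V) (I : Type) (r : seq I)
    (c : I -> F) (y : I -> L) :
  linear f -> f (\sum_(i <- r) c i *: y i) = \sum_(i <- r) c i *: f (y i).
Proof.
move=> fL; apply: (big_rec2 (fun u v => f u = v)) => [|i u v _ <-]; last exact: fL.
exact: linear_fun0.
Qed.

Lemma linear_funB (V : lmodType F) (f : L -> V) x y :
  linear f -> f (x - y) = f x - f y.
Proof. by move=> fL; rewrite addrC -scaleN1r fL scaleN1r addrC. Qed.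

Lemma linear_funD (V : lmodType F) (f : L -> V) : linear f -> {morph f : x y / x + y}.
Proof. by move=> fL x y; have := fL 1 x y; rewrite !scale1r. Qed.

Lemma subspace0 : subspace [set 0 : L].
Proof. by split=> // a x y -> ->; rewrite scaler0 addr0. Qed.

Lemma subspaceI U W : subspace U -> subspace W -> subspace (U `&` W).
Proof.
move=> [U0 UL] [W0 WL]; split=> // a x y [Ux Wx] [Uy Wy].
by split; [apply: UL | apply: WL].
Qed.

Lemma subspace_preim (V : lmodType F) (f : L -> V) (W : set V) :
  linear f -> subspace W -> subspace (f @^-1` W).
Proof.
move=> fL [W0 WL]; split=> [|a x y Wx Wy] /=; first by rewrite linear_fun0.
by rewrite fL; apply: WL.
Qed.

Lemma subspaceZ U a x : subspace U -> U x -> U (a *: x).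
Proof. by move=> [U0 UL] Ux; rewrite -[a *: x]addr0; apply: UL. Qed.

Lemma subspace_big U (I : Type) (r : seq I) (P : pred I) (y : I -> L) :
  subspace U -> (forall i, P i -> U (y i)) -> U (\sum_(i <- r | P i) y i).
Proof.
move=> sU Uy; apply: (big_ind U) => //; first by case: sU.
by move=> x z Ux Uz; apply: subspaceD.
Qed.

Lemma lspan_subspace (S : set L) : subspace (lspan S).
Proof.
split=> [U [[U0 _] _] //|a x y Sx Sy U [sU SU]].
by case: (sU) => _; apply; [apply: Sx | apply: Sy].
Qed.

Lemma lspan_gen (S : set L) : S `<=` lspan S.
Proof. by move=> x Sx U [_]; apply. Qed.

Lemma lspan_sub (S : set L) U : subspace U -> S `<=` U -> lspan S `<=` U.
Proof. by move=> sU SU x; apply. Qed.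

Definition stable_subspace f U := subspace U /\ forall x, U x -> U (f x).

(* [basis_mod] with any finite index type, so that bases can be indexed by sums
   and products of types. *)
Definition fbasis (I : finType) U W (b : I -> L) : Prop :=
  [/\ forall i, U (b i),
      forall x, U x -> exists c : I -> F, W (x - \sum_i c i *: b i)
    & forall c : I -> F, W (\sum_i c i *: b i) -> forall i, c i = 0].

Lemma quo_trace_fin f U W (I : finType) (b : I -> L) (M : I -> I -> F) :
  subspace U -> subspace W ->
  linear f -> (forall x, U x -> W x -> W (f x)) -> fbasis U W b ->
  (forall j, W (f (b j) - \sum_i M i j *: b i)) ->
  quo_trace f U W = \sum_i M i i.
Proof.
move=> sU sW fL fW [Ub gb ib] MP.
have reE (V : nmodType) (g : I -> V) : \sum_i g i = \sum_(i < #|I|) g (enum_val i).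
  rewrite (reindex (enum_val : 'I_#|I| -> I)) //=.
  by exists enum_rank => x _; rewrite ?enum_valK ?enum_rankK.
have bP : basis_mod U W (b \o (enum_val : 'I_#|I| -> I)).
  split=> [i|x /gb[c Wc]|c Wc i]; first exact: Ub.
    by exists (c \o enum_val); move: Wc; rewrite reE.
  have := ib (c \o enum_rank); rewrite reE /=.
  under eq_bigr do rewrite enum_valK.
  by move=> /(_ Wc (enum_val i)); rewrite enum_valK.
rewrite (quo_traceE sU sW (M := \matrix_(i, j) M (enum_val i) (enum_val j)) fL fW bP).
  by rewrite reE; apply: eq_bigr => i _; rewrite mxE.
by move=> j /=; under eq_bigr do rewrite mxE; have := MP (enum_val j); rewrite reE.
Qed.

Lemma fbasis_mx_ex f U W (I : finType) (b : I -> L) :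
  (forall x, U x -> U (f x)) -> fbasis U W b ->
  exists M : I -> I -> F, forall j, W (f (b j) - \sum_i M i j *: b i).
Proof.
move=> fU [Ub gb _].
have /choice[c cP] := fun j => gb _ (fU _ (Ub j)).
by exists (fun i j => c j i).
Qed.

Definition fingen T :=
  exists (I : finType) (y : I -> L),
    forall x, T x -> exists c : I -> F, x = \sum_i c i *: y i.

Lemma indep_card (I J : finType) (b : I -> L) (y : J -> L) :
  (forall i, exists c : J -> F, b i = \sum_j c j *: y j) ->
  (forall c : I -> F, \sum_i c i *: b i = 0 -> forall i, c i = 0) ->
  (#|I| <= #|J|)%N.
Proof.
move=> /choice[A bA] ib.
pose M : 'M[F]_(#|I|, #|J|) := \matrix_(i, j) A (enum_val i) (enum_val j).
suff : row_free M by rewrite /row_free => /eqP <-; apply: rank_leq_col.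
(* A nonzero row in the left kernel of the coefficient matrix would be a linear relation among the
   [b i]. *)
apply/negPn/negP; rewrite -kermx_eq0 => /negP/negP /rowV0Pn[v /sub_kermxP vM v0].
case/negP: v0; apply/eqP/rowP=> i; rewrite mxE.
rewrite -[i]enum_valK; apply: (ib (fun i => v ord0 (enum_rank i))).
under eq_bigr do rewrite bA scaler_sumr.
rewrite exchange_big big1 // => j _.
under eq_bigr do rewrite scalerA.
rewrite -scaler_suml; apply/eqP; rewrite scaler_eq0; apply/orP; left; apply/eqP.
have /rowP/(_ (enum_rank j)) := vM; rewrite !mxE => M0; rewrite -[RHS]M0.
rewrite (reindex (enum_val : 'I_#|I| -> I)) /=; last first.
  by exists enum_rank => x _; rewrite ?enum_valK ?enum_rankK.
by apply: eq_bigr => l _; rewrite mxE enum_valK enum_rankK.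
Qed.

(** Take a family in U of maximal size among those independent modulo W. Sizes are bounded because
    independence modulo W implies independence, and the family lies in the span of finitely many
    vectors. *)
Lemma fbasis_ex T U W : fingen T -> U `<=` T -> subspace W ->
  exists k (b : 'I_k -> L), fbasis U W b.
Proof.
move=> [J [y Ty]] UT sW.
pose indep k := `[< exists b : 'I_k -> L, (forall i, U (b i)) /\
   forall c : 'I_k -> F, W (\sum_i c i *: b i) -> forall i, c i = 0 >].
have ex_indep : exists k, indep k.
  exists 0%N; apply/asboolP; exists (fun=> 0); split=> [[]|c _ []] //.
have bound k : indep k -> (k <= #|J|)%N.
  move=> /asboolP[b [Ub ib]]; rewrite -[k]card_ord.
  apply: (indep_card (b := b) (y := y)).
    by move=> i; apply/Ty/UT.
  by move=> c c0; apply: ib; rewrite c0; case: sW.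
have [k /asboolP[b [Ub ib]] max_k] := ex_maxnP ex_indep bound.
exists k, b; split=> // x Ux; apply: contrapT => nx.
suff : indep k.+1 by move=> /max_k; rewrite ltnn.
apply/asboolP; exists (fun i => if unlift ord0 i is Some j then b j else x).
split=> [i|c]; first by case: unliftP => [j|] _.
rewrite big_ord_recl unlift_none; under eq_bigr do rewrite liftK.
(* Were the coefficient of x nonzero, the relation could be solved for x modulo W, which [nx]
   excludes. *)
move=> Wc; have c0 : c ord0 = 0.
  apply/eqP/negPn/negP => c0; case: nx.
  exists (fun i => - (c ord0)^-1 * c (lift ord0 i)).
  have -> : x - \sum_(i < k) (- (c ord0)^-1 * c (lift ord0 i)) *: b i =
     (c ord0)^-1 *: (c ord0 *: x + \sum_(i < k) c (lift ord0 i) *: b i).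
    rewrite scalerDr scalerA mulVf // scale1r scaler_sumr -sumrN.
    by congr (_ + _); apply: eq_bigr => i _; rewrite scalerA mulNr scaleNr opprK.
  exact: subspaceZ.
move: Wc; rewrite c0 scale0r add0r => /ib cl i.
by case: (unliftP ord0 i) => [j ->|->].
Qed.

(** Basis form of the exact sequence 0 -> (U & W)/Z -> U/Z -> U/W -> 0, with & for intersection. *)
Lemma fbasis_cat U W Z (I J : finType) (b : I -> L) (b' : J -> L) :
  subspace W -> Z `<=` W -> subspace U -> fbasis U W b -> fbasis (U `&` W) Z b' ->
  fbasis U Z (fun s : I + J => match s with inl i => b i | inr j => b' j end).
Proof.
move=> sW ZW sU [Ub gb ib] [Ub' gb' ib']; split.
- by move=> [i|j]; [apply: Ub | case: (Ub' j)].
- move=> x Ux; have [c Wc] := gb x Ux.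
  have UWc : (U `&` W) (x - \sum_i c i *: b i).
    by split=> //; apply: subspaceB => //; apply: subspace_sum.
  have [c' Zc'] := gb' _ UWc.
  exists (fun s => match s with inl i => c i | inr j => c' j end).
  by rewrite big_sumType /= opprD addrA.
- move=> c; rewrite big_sumType /= => Zc.
  have Wc' : W (\sum_j c (inr j) *: b' j).
    by apply: subspace_sum => // j; case: (Ub' j).
  have cl : forall i, c (inl i) = 0.
    apply: (ib (fun i => c (inl i))).
    rewrite -[X in W X](addrK (\sum_j c (inr j) *: b' j)).
    by apply: subspaceB => //; apply: ZW.
  move: Zc; rewrite big1 ?add0r => [|i _]; last by rewrite cl scale0r.
  by move=> /(ib' (fun j => c (inr j))) cr [].
Qed.

Lemma quo_trace_cat T f U W Z : fingen T -> U `<=` T -> Z `<=` W -> linear f ->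
  stable_subspace f U -> stable_subspace f W -> stable_subspace f Z ->
  quo_trace f U Z = quo_trace f U W + quo_trace f (U `&` W) Z.
Proof.
move=> fT UT ZW fL [sU fU] [sW fW] [sZ fZ].
have [I [b bP]] := fbasis_ex fT UT sW.
have UWT : U `&` W `<=` T by move=> x [/UT].
have [J [b' b'P]] := fbasis_ex fT UWT sZ.
have fUW x : (U `&` W) x -> (U `&` W) (f x) by move=> [/fU ? /fW].
have [M MP] := fbasis_mx_ex fU bP; have [M' M'P] := fbasis_mx_ex fUW b'P.
have cP := fbasis_cat sW ZW sU bP b'P.
have [Q QP] := fbasis_mx_ex fU cP.
have sUW := subspaceI sU sW.
rewrite (quo_trace_fin sU sZ fL _ cP QP); last by move=> x _ /fZ.
rewrite big_sumType /=; congr (_ + _).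
  rewrite (quo_trace_fin (M := fun i j => Q (inl i) (inl j)) sU sW fL _ bP) //.
    by move=> x _ /fW.
  move=> j; have := QP (inl j); rewrite big_sumType /= => /ZW.
  set A := \sum_i _; set B := \sum_i _ => WAB.
  have -> : f (b j) - A = (f (b j) - (A + B)) + B.
    by rewrite opprD addrA subrK.
  apply: subspaceD => //; apply: subspace_sum => // i.
  by case: b'P => Ub' _ _; case: (Ub' i).
rewrite (quo_trace_fin (M := fun i j => Q (inr i) (inr j)) sUW sZ fL _ b'P) //.
  by move=> x _ /fZ.
move=> j; have := QP (inr j); rewrite big_sumType /=.
(* Since [f] preserves U and W, the matrix is block triangular: the image of [b' j] has no component
   along the basis of U/W. *)
suff Q0 i : Q (inl i) (inr j) = 0.
  by rewrite big1 ?add0r // => i _; rewrite Q0 scale0r.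
move: i; case: bP => _ _; apply; set A := \sum_i _.
have := QP (inr j); rewrite big_sumType /= -/A; set B := \sum_i _ => /ZW WAB.
have -> : A = (f (b' j) - B) - (f (b' j) - (A + B)).
  by rewrite opprB [RHS]addrC addrA subrK addrK.
apply: subspaceB => //; case: b'P => Ub' _ _.
apply: subspaceB => //; first by apply: fW; case: (Ub' j).
by apply: subspace_sum => // i; case: (Ub' i).
Qed.

Lemma quo_trace_sub f U W : linear f -> stable_subspace f U -> stable_subspace f W ->
  U `<=` W -> quo_trace f U W = 0.
Proof.
move=> fL [sU fU] [sW fW] UW.
have bP : fbasis U W (fun v : void => match v with end : L).
  by split=> [[]|x /UW Wx|c _ []]; exists (fun=> 0); rewrite big1 ?subr0.
rewrite (quo_trace_fin (M := fun _ _ => 0) sU sW fL _ bP); last by case.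
  by rewrite big1.
by move=> x _ /fW.
Qed.

(** U' maps onto U/W, so a basis of U' modulo W, with its matrix, also serves for U. *)
Lemma quo_trace_modeq T f U U' W : fingen T -> U `<=` T -> linear f ->
  stable_subspace f U -> stable_subspace f U' -> stable_subspace f W -> U' `<=` U ->
  (forall x, U x -> exists2 y, U' y & W (x - y)) ->
  quo_trace f U W = quo_trace f U' W.
Proof.
move=> fT UT fL [sU fU] [sU' fU'] [sW fW] U'U UU'.
have U'T : U' `<=` T by move=> x /U'U/UT.
have [I [b bP]] := fbasis_ex fT U'T sW; have [M MP] := fbasis_mx_ex fU' bP.
have fUW V x : V x -> W x -> W (f x) by move=> _ /fW.
rewrite (quo_trace_fin sU' sW fL (fUW U') bP MP).
rewrite (quo_trace_fin (b := b) (M := M) sU sW fL (fUW U)) //.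
case: bP => Ub gb ib; split=> // [i|x /UU'[y /gb[c Wc] Wxy]]; first exact/U'U.
by exists c; rewrite -[x](subrK y) -addrA; apply: subspaceD.
Qed.

Lemma quo_trace_euler T f (N D : nat -> set L) n : fingen T -> linear f ->
  (forall i, N i `<=` T) ->
  (forall i, stable_subspace f (N i)) -> (forall i, stable_subspace f (D i)) ->
  (forall i, (i <= n)%N -> N i `<=` N i.+1) ->
  (forall i, D i.+1 `<=` D i.+2) ->
  (forall i, (1 <= i <= n.+1)%N ->
     subquo_exact (N i.-1) (N i) (D i) (D i.+1)) ->
  N 0%N `<=` [set 0] -> N n.+1 `<=` D n.+2 ->
  \sum_(i < n.+1) (-1) ^+ i * quo_trace f (N i.+1) (D i.+1) = 0.
Proof.
move=> fT fL NT iN iD Ninc Dinc ex N0 Nn.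
(* The traces on the images of the differentials; the alternating sum of the
   traces on the terms telescopes. *)
pose h i := quo_trace f (N i) (D i.+1).
have eE i : (i <= n)%N -> quo_trace f (N i.+1) (D i.+1) = h i.+1 + h i.
  move=> le_in; rewrite (quo_trace_cat fT (NT _) (Dinc i) fL) //; congr (_ + _).
  have iND : stable_subspace f (N i.+1 `&` D i.+2).
    have [sN fN] := iN i.+1; have [sD fD] := iD i.+2.
    by split=> [|x [/fN ? /fD]]; first exact: subspaceI.
  (* [N i.+1] meets [D i.+2] in the kernel of the outgoing differential; by exactness [N i] fills
     this kernel modulo [D i.+1], which gives [h i]. *)
  have exi := ex i.+1 le_in.
  apply: (quo_trace_modeq fT) => //; first by move=> x [/NT].
    move=> x Nx; have Nx' := Ninc i le_in x Nx; split=> //.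
    by apply/(exi x Nx'); exists x => //; rewrite subrr; case: (iD i.+1) => -[].
  by move=> x [Nx Dx]; apply/(exi x Nx).
have h0 : h 0%N = 0.
  apply: quo_trace_sub => // x /N0 ->; by case: (iD 1%N) => -[].
have hn : h n.+1 = 0 by apply: quo_trace_sub.
under eq_bigr => i _ do rewrite eE -1?ltnS // mulrDr.
rewrite big_split /= big_ord_recr /= hn mulr0 addr0.
rewrite [X in _ + X]big_ord_recl /= h0 mulr0 add0r -big_split big1 // => i _.
by rewrite /bump /= add1n exprS mulN1r mulNr addrN.
Qed.

(** * Subspaces and their annihilators under a bilinear form *)

Section Duality.
Variables (T : set L) (B : L -> L -> F).
Hypotheses (fT : fingen T) (sT : subspace T).
Hypothesis B_linl : forall y a x x', B (a *: x + x') y = a * B x y + B x' y.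
Hypothesis B_linr : forall x a y y', B x (a *: y + y') = a * B x y + B x y'.
Hypothesis B_repr : forall phi : L -> F,
  (forall a x y, T x -> T y -> phi (a *: x + y) = a * phi x + phi y) ->
  exists2 z, T z & forall x, T x -> phi x = B x z.
Hypothesis B_nondeg : forall z, T z -> (forall x, T x -> B x z = 0) -> z = 0.

Let BBr x y y' : B x (y - y') = B x y - B x y'.
Proof. by apply: (linear_funB (V := F^o) (f := B x)) => a u u'; apply: B_linr. Qed.

Let Bsuml (I : finType) (c : I -> F) (b : I -> L) y :
  B (\sum_i c i *: b i) y = \sum_i c i * B (b i) y.
Proof.
by apply: (linear_fun_sum (V := F^o) (f := B^~ y)) => a u u'; apply: B_linl.
Qed.

Let Bsumr (I : finType) (c : I -> F) (b : I -> L) x :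
  B x (\sum_i c i *: b i) = \sum_i c i * B x (b i).
Proof.
by apply: (linear_fun_sum (V := F^o) (f := B x)) => a u u'; apply: B_linr.
Qed.

(** Only the part of W inside T is tested: in the main application T is a single degree and W an
    ideal of [TV], which also contains tensors of other degrees. *)
Definition perp W : set L := [set z | T z /\ forall w, T w -> W w -> B w z = 0].

Lemma subspace_perp W : subspace (perp W).
Proof.
split=> [|a x y [Tx Wx] [Ty Wy]]; split; do ?by case: sT => ? HT; do ?apply: HT.
  by move=> w _ _; have := BBr w 0 0; rewrite !subrr.
by move=> w Tw Ww; rewrite B_linr Wx // Wy // mulr0 addr0.
Qed.

(** Coordinates modulo W are unique, hence are linear functionals on T that vanish on W; [B_repr]
    turns them into vectors. *)
Lemma dual_family W (I : finType) (b : I -> L) :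
  subspace W -> fbasis T W b ->
  exists z : I -> L, [/\ forall i, perp W (z i),
    forall i j, B (b j) (z i) = (i == j)%:R
   & forall x, T x -> W (x - \sum_i B x (z i) *: b i)].
Proof.
move=> sW bP; have [Tb gb ib] := bP.
(* Made total, with arbitrary coefficients outside T, so that the choice below yields functions on
   all of [L]. *)
have {}gb : forall x, exists c : I -> F, T x -> W (x - \sum_i c i *: b i).
  by move=> x; case: (pselect (T x)) => [/gb[c]|nTx]; [exists c | exists (fun=> 0)].
have /choice[c cP] := gb.
have c_uniq x (a : I -> F) : T x -> W (x - \sum_i a i *: b i) -> a =1 c x.
  move=> Tx Wa i; apply/eqP; rewrite -subr_eq0; apply/eqP.
  apply: (ib (fun i => a i - c x i)).
  under eq_bigr do rewrite scalerBl.
  rewrite sumrB; have := subspaceB sW (cP x Tx) Wa.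
  by rewrite opprB addrC addrA subrK.
have c_lin i a x y : T x -> T y -> c (a *: x + y) i = a * c x i + c y i.
  move=> Tx Ty; apply/esym; apply: (c_uniq _ (fun i => a * c x i + c y i)).
    by case: sT => _; apply.
  have -> : \sum_i (a * c x i + c y i) *: b i =
     a *: \sum_i c x i *: b i + \sum_i c y i *: b i.
    rewrite scaler_sumr -big_split; apply: eq_bigr => j _ /=.
    by rewrite scalerDl scalerA.
  rewrite opprD addrACA -scalerBr; case: (sW) => _; apply; exact: cP.
have /choice[z zP] : forall i, exists z, T z /\ forall x, T x -> c x i = B x z.
  by move=> i; have [z Tz zP] := B_repr (c_lin i); exists z.
exists z; split=> [i|i j|x Tx].
- have [Tz zE] := zP i; split=> // w Tw Ww; rewrite -zE //; apply/esym.
  apply: (c_uniq w (fun=> 0)) => //; rewrite big1 ?subr0 // => k _.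
  by rewrite scale0r.
- have [_ <- //] := zP i; apply/esym.
  apply: (c_uniq (b j) (fun i => (i == j)%:R)) => //.
  rewrite (bigD1 j) //= eqxx scale1r big1 ?addr0 ?subrr.
    by case: sW.
  by move=> k /negPf ->; rewrite scale0r.
- under eq_bigr => i _ do rewrite -(proj2 (zP i)) //.
  exact: cP.
Qed.

Lemma perp_perp W x : subspace W -> T x ->
  (forall z, perp W z -> B x z = 0) -> W x.
Proof.
move=> sW Tx xP; have [I [b bP]] := fbasis_ex fT (@subset_refl _ T) sW.
have [z [zW _ /(_ x Tx)]] := dual_family sW bP.
by rewrite big1 ?subr0 // => i _; rewrite xP ?scale0r.
Qed.

Lemma fbasis_perp W (I : finType) (b z : I -> L) :
  subspace W -> fbasis T W b -> (forall i, perp W (z i)) ->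
  (forall i j, B (b j) (z i) = (i == j)%:R) ->
  (forall x, T x -> W (x - \sum_i B x (z i) *: b i)) ->
  [/\ fbasis (perp W) [set 0] z
    & forall k, perp W k -> k = \sum_i B (b i) k *: z i].
Proof.
move=> sW [Tb gb ib] zW bz zE.
have kE k : perp W k -> k = \sum_i B (b i) k *: z i.
  move=> Wk; apply/eqP; rewrite -subr_eq0; apply/eqP.
  have [Td Wd] : perp W (k - \sum_i B (b i) k *: z i).
    apply: subspaceB => //; first exact: subspace_perp.
    by apply: subspace_sum => //; apply: subspace_perp.
  apply: B_nondeg => // x Tx.
  (* Split x as [x - x'], which lies in W, plus [x'], a combination of the [b i]: the difference
     between k and its expansion pairs to zero with both. *)
  set x' := \sum_i B x (z i) *: b i.
  have Bx' : B (x - x') (k - \sum_i B (b i) k *: z i) = 0.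
    by apply: Wd (zE x Tx); apply: subspaceB => //; apply: subspace_sum.
  rewrite -[x](subrK x') -[x - x']scale1r B_linl Bx' mulr0 add0r.
  rewrite Bsuml big1 // => j _; rewrite BBr Bsumr (bigD1 j) //= bz eqxx mulr1.
  rewrite big1 ?addr0 ?subrr ?mulr0 // => i /negPf ne; by rewrite bz ne mulr0.
split=> //; split=> // [x Wx|c /= c0 j].
  by exists (fun i => B (b i) x); rewrite /= -kE ?subrr.
have := Bsumr c z (b j); rewrite c0 (bigD1 j) //= bz eqxx mulr1.
rewrite big1 ?addr0 => [<-|i /negPf ne]; last by rewrite bz ne mulr0.
by have := BBr (b j) 0 0; rewrite !subrr.
Qed.

(** In a basis of T/W and the dual basis of [perp W], the adjoint maps [g] and [f] have transposed
    matrices, hence the same diagonal. *)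
Lemma quo_trace_perp W (f g : L -> L) : linear f -> linear g ->
  (forall x, T x -> T (f x)) -> (forall x, T x -> T (g x)) ->
  stable_subspace g W -> (forall x y, T x -> T y -> B (g x) y = B x (f y)) ->
  quo_trace g T W = quo_trace f (perp W) [set 0].
Proof.
move=> fL gL Tf Tg [sW gW] adj.
have [I [b bP]] := fbasis_ex fT (@subset_refl _ T) sW.
have [z [zW bz zE]] := dual_family sW bP.
have [zP kE] := fbasis_perp sW bP zW bz zE.
have [Tb _ _] := bP.
rewrite (quo_trace_fin (M := fun i j => B (g (b j)) (z i)) sT sW gL _ bP); last first.
- by move=> j; apply/zE/Tg.
- by move=> x _ /gW.
rewrite (quo_trace_fin (M := fun i j => B (b i) (f (z j))) (subspace_perp W)
  subspace0 fL _ zP); last first.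
- move=> j /=; rewrite -kE ?subrr //; have [Tz Wz] := zW j.
  by split=> [|w Tw Ww]; [apply: Tf | rewrite -adj // Wz //; [apply: Tg|apply: gW]].
- by move=> x _ /= ->; rewrite linear_fun0.
by apply: eq_bigr => i _; rewrite adj //; case: (zW i).
Qed.

End Duality.

End LinearAlgebra.

Local Notation "1" := (@mone _) : monom_scope.
Local Notation "x * y" := (mmul x y) : monom_scope.

(** * Slicing tensors by words *)

Section WordSlices.
Variable d : nat.
Local Notation word := {fmonom 'I_d}.
Local Notation TV := (TV d).
Implicit Types (a b c m u v w : word) (x y z : TV) (R I : set TV).

Lemma monZE (r : rat) m : << r *g m >> = r *: << m >> :> TV.
Proof. by apply/malgP=> k; rewrite mcoeffZ !mcoeffU mulrnAr mulr1. Qed.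

Lemma mcoeff_linear m : linear (fun x : TV => x@_m : rat^o).
Proof. by move=> a x y; rewrite mcoeffD mcoeffZ. Qed.

Lemma monM a b : << a >> * << b >> = << (a * b)%M >> :> TV.
Proof. by rewrite malgM_def fgmulUU mulr1. Qed.

Lemma TV_sum x : x = \sum_(m <- msupp x) x@_m *: << m >>.
Proof. by rewrite {1}[x]monalgE; apply: eq_bigr => m _; rewrite monZE. Qed.

Lemma mulZr (r : rat) x y : x * (r *: y) = r *: (x * y).
Proof.
rewrite (malgMEw (fsubset_refl _) (msuppZ_le r y)) malgME scaler_sumr.
apply: eq_bigr => i _; rewrite scaler_sumr; apply: eq_bigr => j _.
by rewrite mcoeffZ monZE [in RHS]monZE scalerA mulrCA.
Qed.

Lemma mulZl (r : rat) x y : (r *: x) * y = r *: (x * y).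
Proof. by rewrite -fgscaleAl. Qed.

Lemma mulr_linear x : linear (fun y => x * y).
Proof. by move=> a y z; rewrite mulrDr mulZr. Qed.

Lemma mull_linear y : linear (fun x => x * y).
Proof. by move=> a x z; rewrite mulrDl mulZl. Qed.

Lemma TV_ind (P : set TV) : subspace P -> (forall m, P << m >>) -> forall x, P x.
Proof.
move=> sP Pm x; rewrite [x]TV_sum; apply: subspace_big => // m _.
exact: subspaceZ.
Qed.

Lemma subspace_eq (V : lmodType rat) (f g : TV -> V) :
  linear f -> linear g -> subspace [set x | f x = g x].
Proof.
move=> fL gL; split=> [|a x y /= fx fy] /=; first
  by rewrite (linear_fun0 fL) (linear_fun0 gL).
by rewrite fL gL fx fy.
Qed.

Lemma tpow_subspace n : subspace (tpow d n).
Proof. exact: lspan_subspace. Qed.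
Hint Resolve tpow_subspace : core.

Lemma tpow_mon m n : fdeg m = n -> tpow d n << m >>.
Proof. by move=> mn; apply: lspan_gen; exists m. Qed.

Lemma tpow_ind n (P : set TV) : subspace P ->
  (forall m, fdeg m = n -> P << m >>) -> tpow d n `<=` P.
Proof. by move=> sP Pm; apply: lspan_sub => // _ [m mn ->]; apply: Pm. Qed.

Lemma tpow_coeff n x m : tpow d n x -> fdeg m != n -> x@_m = 0.
Proof.
move=> + mn; move: x; apply: tpow_ind.
  apply: (subspace_eq (V := rat^o)); first exact: mcoeff_linear.
  by move=> a x y; rewrite scaler0 addr0.
move=> k kn /=; rewrite mcoeffU1.
by case: eqP => // km; move: mn; rewrite -km kn eqxx.
Qed.

Lemma tpowP n x : tpow d n x <-> forall m, fdeg m != n -> x@_m = 0.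
Proof.
split=> [Tx m|x0]; first exact: tpow_coeff.
rewrite [x]TV_sum; apply: subspace_big => // m _.
have [/tpow_mon Tm|/x0 ->] := eqVneq (fdeg m) n.
  exact: (subspaceZ _ (tpow_subspace n) Tm).
by rewrite scale0r; case: (tpow_subspace n).
Qed.

Lemma tpowM p q x y : tpow d p x -> tpow d q y -> tpow d (p + q) (x * y).
Proof.
move=> + Ty; move: x; apply: tpow_ind.
  by apply: (subspace_preim (W := tpow d (p + q)) (mull_linear y)).
move=> a ap /=; move: y Ty; apply: tpow_ind.
  by apply: (subspace_preim (W := tpow d (p + q)) (mulr_linear << a >>)).
by move=> b bq /=; rewrite monM; apply: tpow_mon; rewrite fdegM ap bq.
Qed.

(** The action [tact M] unfolds to an instance of this, and gets its linearity from here. *)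
Definition linext (h : word -> TV) : TV -> TV := mmap (fun c : rat => c%:MP) h.

Lemma linext_linear h : linear (linext h).
Proof.
have E : linext h = fun x => \sum_(k <- msupp x) x@_k *: h k.
  by apply/funext=> x; apply: eq_bigr => m _; rewrite mul_malgC.
move=> a x y; rewrite [LHS](mmapD (f := malgC)) -/(linext h) -/(linext h).
congr (_ + _); rewrite [LHS](mmapEw (f := malgC) (msuppZ_le a x)) E scaler_sumr.
by apply: eq_bigr => m _; rewrite mul_malgC mcoeffZ scalerA.
Qed.

Lemma linext_mon h m : linext h << m >> = h m.
Proof. by rewrite [LHS](mmapU (f := malgC)) mul_malgC scale1r. Qed.

(* [mid a b] contracts the outer tensor factors with the dual basis words of
   [a] (on the left) and [b] (on the right). *)
Definition mid a b : TV -> TV := locked (linext (fun m =>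
  let c : word := FMonom (take (fdeg m - fdeg a - fdeg b) (drop (fdeg a) m)) in
  if m == (a * c * b)%M then << c >> else 0)).

Lemma mid_linear a b : linear (mid a b).
Proof. by rewrite /mid -lock; apply: linext_linear. Qed.
Hint Resolve mid_linear : core.

Lemma word_inj a b : (a : seq _) = b -> a = b.
Proof. by move=> ab; apply/eqP; rewrite fmP; apply/eqP. Qed.

Lemma mcoeff_mid a b x c : (mid a b x)@_c = x@_(a * c * b)%M.
Proof.
move: x; apply: (TV_ind (P := [set x | (mid a b x)@_c = x@_(a * c * b)%M])).
  apply: (subspace_eq (V := rat^o)); last exact: mcoeff_linear.
  by move=> r x y; rewrite mid_linear; apply: mcoeff_linear.
move=> m /=; rewrite /mid -lock linext_mon mcoeffU1; set c' := FMonom _.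
case: (eqVneq m (a * c * b)%M) => [mE|mNE].
  suff -> : c' = c by rewrite {1}mE eqxx mcoeffU1 eqxx.
  apply: word_inj; rewrite /c' mE !fdegE !fmM -catA drop_size_cat // !size_cat.
  by rewrite addnC addnK addnK take_size_cat.
case: eqP => [mE|_]; last by rewrite mcoeff0.
by rewrite mcoeffU1; case: eqP => // cc; rewrite mE cc eqxx in mNE.
Qed.

Lemma mid_mid a b a' b' x : mid a b (mid a' b' x) = mid (a' * a)%M (b * b')%M x.
Proof. by apply/malgP=> c; rewrite !mcoeff_mid !mulmA.
Qed.

Lemma tpow_mid n a b x : tpow d (fdeg a + n + fdeg b) x -> tpow d n (mid a b x).
Proof.
move=> /tpowP x0; apply/tpowP=> m mn; rewrite mcoeff_mid x0 // !fdegM.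
by rewrite eqn_add2r eqn_add2l.
Qed.

Lemma word_mulI a b u v : fdeg a = fdeg u -> (a * b = u * v)%M -> a = u /\ b = v.
Proof.
move=> au /(congr1 (@fmonom_val _)); rewrite !fmM => /eqP.
by rewrite eqseq_cat // => /andP[/eqP/word_inj ? /eqP/word_inj].
Qed.

Lemma word_mul3_eq a b c u v w : fdeg a = fdeg u -> fdeg b = fdeg v ->
  ((u * w * v)%M == (a * c * b)%M) = [&& u == a, v == b & w == c].
Proof.
move=> au bv; apply/eqP/and3P => [E|[/eqP-> /eqP-> /eqP->] //].
have wc : fdeg w = fdeg c.
  by have := congr1 (@fdeg _) E; rewrite !fdegM au bv => /addIn/addnI.
have uwac : fdeg (u * w)%M = fdeg (a * c)%M by rewrite !fdegM au wc.
have [E' ->] := word_mulI uwac E; have [-> ->] := word_mulI (esym au) E'.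
by rewrite !eqxx.
Qed.

Lemma mid_mul a b y x z : tpow d (fdeg a) y -> tpow d (fdeg b) z ->
  mid a b (y * x * z) = (y@_a * z@_b) *: x.
Proof.
move=> + Tz; move: y; apply: tpow_ind.
  apply: subspace_eq => [r y y'|r y y'].
    by rewrite mulrDl mulrDl !mulZl mid_linear.
  by rewrite mcoeffD mcoeffZ mulrDl scalerDl scalerA mulrA.
move=> u ua; move: z Tz; apply: tpow_ind.
  apply: subspace_eq => [r z z'|r z z'].
    by rewrite mulrDr !mulZr mid_linear.
  by rewrite mcoeffD mcoeffZ mulrDr scalerDl scalerA mulrCA.
move=> v vb; move: x.
apply: (TV_ind (P := [set x | _ = _])).
  apply: subspace_eq => [r x x'|r x x'].
    by rewrite mulrDr mulrDl mulZr mulZl mid_linear.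
  by rewrite scalerDr !scalerA [r * _]mulrC.
move=> m /=; apply/malgP=> c; rewrite !monM mcoeff_mid mcoeffZ !mcoeffU1.
rewrite word_mul3_eq // -natrM -natrM; congr (_%:R).
by case: (u == a); case: (v == b); case: (m == c).
Qed.

Definition words n (t : n.-tuple 'I_d) : word := FMonom t.

Lemma fdeg_words n (t : n.-tuple 'I_d) : fdeg (words t) = n.
Proof. by rewrite fdegE /= size_tuple. Qed.

Lemma words_ex n m : fdeg m = n -> exists t : n.-tuple 'I_d, m = words t.
Proof.
by move=> mn; exists (Tuple (introT eqP mn)); apply: word_inj.
Qed.

Lemma words_inj n : injective (@words n).
Proof. by move=> s t [st]; apply: val_inj. Qed.

(** A word of length n >= p + q has one prefix of length p and one suffix of length q, so on a word
    exactly one summand survives, and it restores the word. *)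
Lemma mid_decomp p q n x : (p + q <= n)%N -> tpow d n x ->
  x = \sum_(s : p.-tuple 'I_d) \sum_(t : q.-tuple 'I_d)
        << words s >> * mid (words s) (words t) x * << words t >>.
Proof.
move=> le_pqn; move: x; apply: tpow_ind.
  apply: subspace_eq => [r x y //|r x y].
  rewrite scaler_sumr -big_split; apply: eq_bigr => s _ /=.
  rewrite scaler_sumr -big_split; apply: eq_bigr => t _ /=.
  by rewrite mid_linear mulrDr mulrDl mulZr mulZl.
move=> m mn /=.
have [s [c [t ->]]] : exists (s : p.-tuple 'I_d) c (t : q.-tuple 'I_d),
    m = (words s * c * words t)%M.
  have sz : size m = n by [].
  have le_pn : (p <= n)%N by apply: leq_trans le_pqn; apply: leq_addr.
  have s1 : fdeg (FMonom (take p m)) = p by rewrite fdegE /= size_takel ?sz.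
  have s3 : fdeg (FMonom (drop (n - q) m)) = q.
    by rewrite fdegE /= size_drop sz subKn // (leq_trans _ le_pqn) ?leq_addl.
  have [s sE] := words_ex s1; have [t tE] := words_ex s3.
  exists s, (FMonom (drop p (take (n - q) m))), t; rewrite -sE -tE.
  apply: word_inj; rewrite !fmM /=.
  have le_pnq : (p <= n - q)%N by lia.
  by rewrite -{1}(take_takel m le_pnq) cat_take_drop cat_take_drop.
have midE (s' : p.-tuple 'I_d) (t' : q.-tuple 'I_d) :
  mid (words s') (words t') << (words s * c * words t)%M >> =
    ((words s == words s')%:R * (words t == words t')%:R) *: << c >>.
  by rewrite -!monM mid_mul ?mcoeffU1 //; apply: tpow_mon; rewrite !fdeg_words.
rewrite (bigD1 s) // [X in _ = X + _](bigD1 t) // midE !eqxx mulr1 scale1r.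
rewrite [X in _ = _ + X]big1 => [|s' /negPf ne_s]; last first.
  rewrite big1 // => t' _.
  rewrite midE [words s == _](inj_eq (@words_inj _)) eq_sym ne_s.
  by rewrite mul0r scale0r mulr0 mul0r.
rewrite [X in _ = _ + X + _]big1 => [|t' /negPf ne_t]; last first.
  rewrite midE [words t == _](inj_eq (@words_inj _)) eq_sym ne_t.
  by rewrite mulr0 scale0r mulr0 mul0r.
by rewrite !addr0 monM monM.
Qed.

Section Quadratic.
Variable R : set TV.
Hypotheses (sR : subspace R) (R2 : R `<=` tpow d 2).

Lemma koszul_X_subspace n j : subspace (koszul_X R n j).
Proof. exact: lspan_subspace. Qed.

Lemma koszul_X_mul (n j : nat) (u r v : TV) :
  tpow d (j - 1) u -> R r -> tpow d (n - 1 - j) v ->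
  koszul_X R n j (u * r * v).
Proof. by move=> Tu Rr Tv; apply: lspan_gen; exists u, r, v. Qed.

Lemma koszul_X_tpow n j : (1 <= j < n)%N -> koszul_X R n j `<=` tpow d n.
Proof.
move=> /andP[j0 jn]; apply: lspan_sub => // _ [u [r [v [Tu Rr Tv ->]]]].
have -> : n = (j - 1 + 2 + (n - 1 - j))%N.
  by lia.
by do 2?apply: tpowM => //; apply: R2.
Qed.

(** Membership in a span becomes a condition on every slice, a form suited to intersections.
    Contracting u r v by words leaves a multiple of r, and conversely x is reassembled from its
    slices. *)
Lemma koszul_XP n j x : (1 <= j < n)%N ->
  koszul_X R n j x <-> tpow d n x /\
    (forall a b, fdeg a = (j - 1)%N -> fdeg b = (n - 1 - j)%N -> R (mid a b x)).
Proof.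
move=> jn; split=> [Xx|[Tx Rx]].
  split=> [|a b aj bj]; first exact: koszul_X_tpow jn _ Xx.
  move: x Xx; apply: lspan_sub => [|_ [u [r [v [Tu Rr Tv ->]]]]].
    exact: subspace_preim.
  by rewrite /preimage /= mid_mul ?aj ?bj //; apply: subspaceZ.
have le_n : (j - 1 + (n - 1 - j) <= n)%N by lia.
rewrite (mid_decomp le_n Tx); apply: subspace_big => [|s _].
  exact: koszul_X_subspace.
apply: subspace_big => [|t _]; first exact: koszul_X_subspace.
apply: koszul_X_mul; rewrite ?fdeg_words //.
- by apply: tpow_mon; rewrite fdeg_words.
- by apply: Rx; rewrite fdeg_words.
- by apply: tpow_mon; rewrite fdeg_words.
Qed.

End Quadratic.
End WordSlices.

(** * The pairing of words, the ideal of R, and slices of the Koszul terms *)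

Section PairingAndIdeals.
Variable d : nat.
Local Notation word := {fmonom 'I_d}.
Local Notation TV := (TV d).
Implicit Types (a b c m u v w : word) (x y z : TV) (R I : set TV).
Hint Resolve tpow_subspace mid_linear : core.

Lemma tpow1 : tpow d 0 (1 : TV).
Proof. by apply: tpow_mon; rewrite fdeg1. Qed.

Lemma mid_mull a y x : tpow d (fdeg a) y -> mid a 1%M (y * x) = y@_a *: x.
Proof.
move=> Ty; have T1 : tpow d (fdeg (1%M : word)) 1 by rewrite fdeg1; apply: tpow1.
by rewrite -{1}[y * x]mulr1 (mid_mul _ Ty T1) mcoeffU1 eqxx mulr1.
Qed.

Lemma mid_mulr b x z : tpow d (fdeg b) z -> mid 1%M b (x * z) = z@_b *: x.
Proof.
move=> Tz; have T1 : tpow d (fdeg (1%M : word)) 1 by rewrite fdeg1; apply: tpow1.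
by rewrite -{1}[x]mul1r (mid_mul _ T1 Tz) mcoeffU1 eqxx mul1r.
Qed.

Lemma words0 (t : 0.-tuple 'I_d) : words t = 1%M.
Proof. by apply: word_inj; rewrite fm1 tuple0. Qed.

Lemma sum_tuple0 (f : 0.-tuple 'I_d -> TV) : \sum_t f t = f [tuple].
Proof.
by rewrite (bigD1 [tuple]) //= big1 ?addr0 // => t /eqP[]; apply: tuple0.
Qed.

Lemma mid_decompl p n x : (p <= n)%N -> tpow d n x ->
  x = \sum_(s : p.-tuple 'I_d) << words s >> * mid (words s) 1%M x.
Proof.
move=> le_pn Tx; have le_pn0 : (p + 0 <= n)%N by rewrite addn0.
rewrite {1}(mid_decomp le_pn0 Tx).
by apply: eq_bigr => s _; rewrite sum_tuple0 words0 [_ * << 1%M >>]mulr1.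
Qed.

Lemma mid_decompr q n x : (q <= n)%N -> tpow d n x ->
  x = \sum_(t : q.-tuple 'I_d) mid 1%M (words t) x * << words t >>.
Proof.
move=> le_qn Tx; have le_qn0 : (0 + q <= n)%N by [].
rewrite {1}(mid_decomp le_qn0 Tx) sum_tuple0 words0.
by apply: eq_bigr => t _; rewrite [<< 1%M >> * _]mul1r.
Qed.

Lemma tpow_sum n x : tpow d n x ->
  x = \sum_(t : n.-tuple 'I_d) x@_(words t) *: << words t >>.
Proof.
move=> Tx; apply/malgP=> m; rewrite raddf_sum /=.
under eq_bigr do rewrite mcoeffZ mcoeffU1.
have [/words_ex[t ->]|mn] := eqVneq (fdeg m) n.
  rewrite (bigD1 t) //= eqxx mulr1 big1 ?addr0 // => s /negPf ne_s.
  by rewrite (inj_eq (@words_inj _ _)) ne_s mulr0.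
rewrite (tpow_coeff Tx mn) big1 // => t _; case: eqP => [tm|]; last by rewrite mulr0.
by rewrite -tm fdeg_words eqxx in mn.
Qed.

Lemma fingen_tpow n : fingen (tpow d n).
Proof.
exists (n.-tuple 'I_d), (fun t => << words t >>) => x Tx.
by exists (fun t => x@_(words t)); apply: tpow_sum.
Qed.

Lemma tpairing_linl x (a : rat) (f g : TV) :
  tpairing (a *: f + g) x = a * tpairing f x + tpairing g x.
Proof.
(* [tpairing] sums over the support of its left argument, which varies; written as a coefficient of
   a linear extension, it is visibly linear there. *)
have E h : tpairing h x = (linext (fun m => x@_m *: 1) h)@_(1%M).
  rewrite /linext /mmap raddf_sum /=; apply: eq_bigr => m _.
  by rewrite mul_malgC scalerA mcoeffZ mcoeff1 eqxx mulr1.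
by rewrite !E linext_linear mcoeffD mcoeffZ.
Qed.

Lemma tpairing_linr (f : TV) (a : rat) x y :
  tpairing f (a *: x + y) = a * tpairing f x + tpairing f y.
Proof.
rewrite /tpairing mulr_sumr -big_split; apply: eq_bigr => m _ /=.
by rewrite mcoeffD mcoeffZ mulrDr mulrCA.
Qed.

Lemma tpairing_mon m x : tpairing << m >> x = x@_m.
Proof.
by rewrite /tpairing msuppU1 big_seq_fset1 mcoeffU1 eqxx mul1r.
Qed.

Lemma tpairingC (f g : TV) : tpairing f g = tpairing g f.
Proof.
move: f; apply: (TV_ind (P := [set f | tpairing f g = tpairing g f])) => [|m /=].
  apply: (subspace_eq (V := rat^o)) => a x y; first exact: tpairing_linl.
  exact: tpairing_linr.
rewrite tpairing_mon; move: g.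
apply: (TV_ind (P := [set g | g@_m = tpairing g << m >>])) => [|k /=].
  apply: (subspace_eq (V := rat^o)); first exact: mcoeff_linear.
  by move=> a x y; apply: tpairing_linl.
by rewrite tpairing_mon !mcoeffU1 eq_sym.
Qed.

Lemma tpairing_monr m x : tpairing x << m >> = x@_m.
Proof. by rewrite tpairingC tpairing_mon. Qed.

Lemma tpairing_words n (f : TV) x : tpow d n f ->
  tpairing f x = \sum_(t : n.-tuple 'I_d) f@_(words t) * x@_(words t).
Proof.
move=> Tf; rewrite {1}(tpow_sum Tf).
rewrite (linear_fun_sum (V := rat^o) (f := (@tpairing d)^~ x)).
  by apply: eq_bigr => t _; rewrite tpairing_mon.
by move=> a f' g; apply: tpairing_linl.
Qed.

Lemma tpairing_nondeg n z : tpow d n z ->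
  (forall x, tpow d n x -> tpairing x z = 0) -> z = 0.
Proof.
move=> Tz z0; apply/malgP=> m; rewrite mcoeff0.
have [mn|mn] := eqVneq (fdeg m) n; last exact: tpow_coeff Tz mn.
by rewrite -tpairing_mon z0 //; apply: tpow_mon.
Qed.

Lemma tpairing_repr n (phi : TV -> rat) :
  (forall (a : rat) x y, tpow d n x -> tpow d n y ->
    phi (a *: x + y) = a * phi x + phi y) ->
  exists2 z, tpow d n z & forall x, tpow d n x -> phi x = tpairing x z.
Proof.
move=> phiL; have sT := @tpow_subspace d n.
have phi0 : phi 0 = 0.
  have [T0 _] := sT; have := phiL 1 0 0 T0 T0.
  rewrite scaler0 addr0 mul1r => /eqP.
  by rewrite -subr_eq0 opprD addNKr oppr_eq0 => /eqP.
(* Words are orthonormal for the pairing, so the coefficients of the representing vector are the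
   values of [phi] on words. *)
pose z : TV := \sum_(t : n.-tuple 'I_d) phi << words t >> *: << words t >>.
have Tz : tpow d n z.
  apply: subspace_big => // t _; apply: (subspaceZ _ sT).
  by apply: tpow_mon; rewrite fdeg_words.
have zE (t : n.-tuple 'I_d) : z@_(words t) = phi << words t >>.
  rewrite /z raddf_sum /=; under eq_bigr do rewrite mcoeffZ mcoeffU1.
  rewrite (bigD1 t) //= eqxx mulr1 big1 ?addr0 // => s /negPf ne_s.
  by rewrite (inj_eq (@words_inj _ _)) ne_s mulr0.
exists z => // x Tx.
(* Membership in [tpow d n] is carried along the induction because [phi] is linear only there. *)
suff /(_ x Tx) [] : tpow d n `<=` [set x | tpow d n x /\ phi x = tpairing x z] by [].
apply: tpow_ind => [|m mn /=].
  split=> /= [|a u v [Tu uE] [Tv vE]]; last first.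
    by split; [case: sT => _; apply | rewrite phiL // tpairing_linl uE vE].
  split; first by case: sT.
  by rewrite phi0 /tpairing msupp0 big_seq_fset0.
split; first exact: tpow_mon.
by have [t ->] := words_ex mn; rewrite tpairing_mon zE.
Qed.

Lemma tpairing_mid a b (f : TV) x :
  tpairing (<< a >> * f * << b >>) x = tpairing f (mid a b x).
Proof.
move: f; apply: (TV_ind (P := [set f | tpairing _ _ = tpairing f _])) => [|m /=].
  apply: (subspace_eq (V := rat^o)) => r f g; last exact: tpairing_linl.
  by rewrite mulrDr mulrDl mulZr mulZl; apply: tpairing_linl.
by rewrite monM monM !tpairing_mon mcoeff_mid.
Qed.

Lemma ideal_gen_ideal R : two_sided_ideal (ideal_gen R).
Proof.
split=> [|a x Ix].
  split=> [I [[[I0 _] _] _] //|a x y Ix Iy I [iI RI]].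
  by case: (iI) => -[_ +] _; apply; [apply: Ix | apply: Iy].
by split=> I [iI RI]; have [] := proj2 iI a x (Ix I (conj iI RI)).
Qed.

Lemma ideal_gen_subspace R : subspace (ideal_gen R).
Proof. by case: (ideal_gen_ideal R). Qed.
Hint Resolve ideal_gen_subspace : core.

Lemma ideal_genMl R (y x : TV) : ideal_gen R x -> ideal_gen R (y * x).
Proof. by move=> Ix; have [] := proj2 (ideal_gen_ideal R) y x Ix. Qed.

Lemma ideal_genMr R (y x : TV) : ideal_gen R x -> ideal_gen R (x * y).
Proof. by move=> Ix; have [] := proj2 (ideal_gen_ideal R) y x Ix. Qed.

Lemma ideal_gen_gen R : R `<=` ideal_gen R.
Proof. by move=> x Rx I [_]; apply. Qed.

Lemma ideal_gen_sub R I : two_sided_ideal I -> R `<=` I -> ideal_gen R `<=` I.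
Proof. by move=> iI RI x; apply. Qed.

Definition homog_part (n : nat) : TV -> TV :=
  linext (fun m => if fdeg m == n then << m >> else 0).

Lemma homog_part_linear n : linear (homog_part n).
Proof. exact: linext_linear. Qed.

Lemma homog_part_tpow n p x : tpow d p x ->
  homog_part n x = if p == n then x else 0.
Proof.
move: x; apply: tpow_ind => [|m mp /=]; last by rewrite /homog_part linext_mon mp.
apply: subspace_eq => [|r x y]; first exact: homog_part_linear.
by case: ifP => // _; rewrite scaler0 addr0.
Qed.

Section Quadratic.
Variable R : set TV.
Hypotheses (sR : subspace R) (R2 : R `<=` tpow d 2).

Lemma koszul_den_subspace n i : subspace (koszul_den R n i).
Proof. by rewrite /koszul_den; case: ifP => _; exact: lspan_subspace. Qed.
Hint Resolve koszul_den_subspace : core.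

Lemma koszul_den_gen n i (j : nat) x : (i <= n.+1)%N -> (1 <= j <= i - 2)%N ->
  koszul_X R n j x -> koszul_den R n i x.
Proof.
by move=> le_in ji Xx; rewrite /koszul_den le_in; apply: lspan_gen; exists j.
Qed.

Lemma koszul_den_ind n i (P : set TV) : (i <= n.+1)%N -> subspace P ->
  (forall j (u r v : TV), (1 <= j <= i - 2)%N -> tpow d (j - 1) u -> R r ->
     tpow d (n - 1 - j) v -> P (u * r * v)) -> koszul_den R n i `<=` P.
Proof.
move=> le_in sP Pj; rewrite /koszul_den le_in; apply: lspan_sub => // x [j /= ji].
move: x; apply: lspan_sub => // _ [u [r [v [Tu Rr Tv ->]]]].
exact: (Pj j).
Qed.

Lemma koszul_den_tpow n i : koszul_den R n i `<=` tpow d n.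
Proof.
have [le_in|lt_ni] := leqP i n.+1; last by rewrite /koszul_den leqNgt lt_ni.
apply: koszul_den_ind => // j u r v ji Tu Rr Tv.
have -> : n = (j - 1 + 2 + (n - 1 - j))%N by lia.
by do 2?apply: tpowM => //; apply: R2.
Qed.

(** The ideal is spanned by products of a word, an element of R and a word. Each is homogeneous, so
    projecting to degree n keeps exactly those of total length n. The index n+1 is the one whose
    denominator is the full sum X_1 + ... + X_(n-1). *)
Lemma ideal_gen_den n x : tpow d n x -> ideal_gen R x -> koszul_den R n n.+1 x.
Proof.
move=> Tx Ix; rewrite -[x](_ : homog_part n x = x); last first.
  by rewrite (homog_part_tpow _ Tx) eqxx.
pose S : set TV :=
  [set y | exists a r b, R r /\ y = << a >> * r * << b >>].
have SE : S `<=` [set y | koszul_den R n n.+1 (homog_part n y)].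
  move=> _ [a [r [b [Rr ->]]]] /=.
  have Tarb : tpow d (fdeg a + 2 + fdeg b) (<< a >> * r * << b >>).
    by do 2?apply: tpowM; [apply: tpow_mon | apply: R2 | apply: tpow_mon].
  rewrite (homog_part_tpow _ Tarb); case: eqP => [nE|_]; last first.
    by case: (koszul_den_subspace n n.+1).
  (* The factor r follows the [fdeg a] letters of a, so it starts at position [(fdeg a).+1]. *)
  apply: (@koszul_den_gen _ _ (fdeg a).+1) => //; first lia.
  by apply: koszul_X_mul => //; apply: tpow_mon; lia.
suff : lspan S x.
  have sP := subspace_preim (homog_part_linear n) (koszul_den_subspace n n.+1).
  by move=> Sx; exact: (lspan_sub sP SE Sx).
move: x Ix {Tx}; apply: ideal_gen_sub => [|r Rr]; last first.
  apply: lspan_gen; exists 1%M, r, 1%M; split=> //.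
  by rewrite -/(1 : TV) mulr1 mul1r.
split=> [|a x Sx]; first exact: lspan_subspace.
have sS := lspan_subspace S.
split.
  move: a; apply: (TV_ind (P := [set a | lspan S (a * x)])) => [|m /=].
    exact: (subspace_preim (mull_linear x)).
  move: x Sx; apply: lspan_sub => [|_ [a [r [b [Rr ->]]]]].
    exact: (subspace_preim (mulr_linear << m >>)).
  by apply: lspan_gen; exists (m * a)%M, r, b; rewrite -monM !mulrA.
move: a; apply: (TV_ind (P := [set a | lspan S (x * a)])) => [|m /=].
  exact: (subspace_preim (mulr_linear x)).
move: x Sx; apply: lspan_sub => [|_ [a [r [b [Rr ->]]]]].
  exact: (subspace_preim (mull_linear << m >>)).
by apply: lspan_gen; exists a, r, (b * m)%M; rewrite -monM !mulrA.
Qed.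

(** X_1, ..., X_(p-1) place R within the first p letters and leave the last m free, so contractions
    on the right suffice. Conversely the slices have degree p, where [ideal_gen_den] applies. *)
Lemma koszul_denP (p m : nat) x : koszul_den R (p + m) p.+1 x <-> tpow d (p + m) x /\
  forall b, fdeg b = m -> ideal_gen R (mid 1%M b x).
Proof.
have le_pm : (p.+1 <= (p + m).+1)%N by rewrite ltnS leq_addr.
split=> [Dx|[Tx Ix]].
  split=> [|b bm]; first exact: koszul_den_tpow Dx.
  move: x Dx; apply: koszul_den_ind => // [|j u r v jp Tu Rr Tv].
    exact: (subspace_preim (mid_linear 1%M b) (ideal_gen_subspace R)).
  have vL : linear (fun v : TV => mid 1%M b (u * r * v)).
    by move=> s y z; rewrite mulrDr mulZr mid_linear.
  move: v Tv; apply: (tpow_ind (subspace_preim vL (ideal_gen_subspace R))) => w wE /=.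
  (* R occupies letters j and j+1 with j+1 <= p, so the word after it contains all of the last m
     letters, collected in [w2]. *)
  have [w1 [w2 [-> w2m]]] : exists w1 w2, w = (w1 * w2)%M /\ fdeg w2 = m.
    exists (FMonom (take (size w - m) w)), (FMonom (drop (size w - m) w)).
    split; first by apply: word_inj; rewrite fmM /= cat_take_drop.
    by rewrite fdegE /= size_drop; move: wE; rewrite fdegE => ->; lia.
  rewrite -monM mulrA mid_mulr; last by apply: tpow_mon; rewrite bm.
  apply: (subspaceZ _ (ideal_gen_subspace R)).
  by apply: ideal_genMr; apply: ideal_genMl; apply: ideal_gen_gen.
rewrite (mid_decompr (leq_addl p m) Tx).
apply: subspace_big (koszul_den_subspace _ _) _ => t _.
have : koszul_den R p p.+1 (mid 1%M (words t) x).
  apply: ideal_gen_den; last by apply: Ix; rewrite fdeg_words.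
  by apply: tpow_mid; rewrite fdeg1 fdeg_words.
have sP := subspace_preim (mull_linear << words t >>)
  (koszul_den_subspace (p + m) p.+1).
apply: (koszul_den_ind (leqnn _) sP) => j u r v jp Tu Rr Tv.
rewrite /preimage /= -mulrA; apply: (@koszul_den_gen _ _ j) => //.
apply: koszul_X_mul => //.
have -> : (p + m - 1 - j = p - 1 - j + m)%N by lia.
by apply: tpowM => //; apply: tpow_mon; rewrite fdeg_words.
Qed.

Lemma koszul_num_subspace n i : subspace (koszul_num R n i).
Proof.
rewrite /koszul_num; case: ifP => _; first exact: subspace0.
apply: subspaceI => //; split=> [j _|a x y Xx Xy j ji].
  by case: (koszul_X_subspace R n j).
by case: (koszul_X_subspace R n j) => _; apply; [apply: Xx | apply: Xy].
Qed.
Hint Resolve koszul_num_subspace : core.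

Lemma koszul_num_tpow n i : koszul_num R n i `<=` tpow d n.
Proof.
rewrite /koszul_num; case: ifP => _ x; last by case.
by move=> ->; case: (@tpow_subspace d n).
Qed.

(** X_(p+1), ..., X_(p+m-1) leave the first p letters free, and X_(p+j) in degree p+m becomes X_j in
    degree m on the slices. [koszul_num R m 1] is K_m, its intersection running over all
    positions. *)
Lemma koszul_numP (p m : nat) x : koszul_num R (p + m) p.+1 x <-> tpow d (p + m) x /\
  forall a, fdeg a = p -> koszul_num R m 1 (mid a 1%M x).
Proof.
rewrite /koszul_num /=; split=> [[Tx Xx]|[Tx Kx]]; split=> //.
  move=> a ap; have Tax : tpow d m (mid a 1%M x).
    by apply: tpow_mid; rewrite ap fdeg1 addn0.
  split=> // j /= jm; apply/(koszul_XP sR R2) => //; split=> // a' b' a'E b'E.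
  rewrite mid_mid mulm1.
  have pjm : (p.+1 <= p + j < p + m)%N by lia.
  have pjm' : (1 <= p + j < p + m)%N by lia.
  have /(koszul_XP sR R2) := Xx _ pjm; case/(_ pjm') => _; apply.
    by rewrite fdegM ap a'E; lia.
  by rewrite b'E; lia.
move=> j /= jp; apply/(koszul_XP sR R2); first lia.
split=> // a b aE bE.
have [a1 [a2 [aE' a1p]]] : exists a1 a2, a = (a1 * a2)%M /\ fdeg a1 = p.
  exists (FMonom (take p a)), (FMonom (drop p a)).
  split; first by apply: word_inj; rewrite fmM /= cat_take_drop.
  by rewrite fdegE /= size_takel //; move: aE; rewrite fdegE => ->; lia.
have a2E : fdeg a2 = (j - p - 1)%N.
  by apply/(@addnI p); rewrite -{1}a1p -fdegM -aE'; lia.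
rewrite aE' -[b]mulm1 -mid_mid; have [_ /(_ (j - p)%N)] := Kx _ a1p.
have jpm : (1 <= j - p < m)%N by lia.
case/(_ jpm)/(koszul_XP sR R2) => // _; apply; first by rewrite a2E; lia.
by rewrite bE; lia.
Qed.

End Quadratic.
End PairingAndIdeals.

(** * The diagonal action *)

Section DiagonalAction.
Variable d : nat.
Local Notation word := {fmonom 'I_d}.
Local Notation TV := (TV d).
Implicit Types (a b c m u v w : word) (x y z : TV) (R I : set TV).

Lemma tact_linear (M : 'M[rat]_d) : linear (tact M).
Proof. exact: linext_linear. Qed.

Lemma tact_mon (M : 'M[rat]_d) m : tact M << m >> =
  \prod_(j <- (m : seq 'I_d)) \sum_i << M i j *g fmu i >>.
Proof. exact: linext_mon. Qed.

Lemma tact1 (M : 'M[rat]_d) : tact M 1 = 1.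
Proof. by rewrite -[in LHS]/(<< 1%M >> : TV) tact_mon fm1 big_nil. Qed.

Lemma tact_fmu (M : 'M[rat]_d) j : tact M << fmu j >> = \sum_i M i j *: << fmu i >>.
Proof.
rewrite tact_mon fmU big_seq1; apply: eq_bigr => i _; exact: monZE.
Qed.

Lemma tactM (M : 'M[rat]_d) x y : tact M (x * y) = tact M x * tact M y.
Proof.
move: x; apply: (TV_ind (P := [set x | tact M (x * y) = tact M x * tact M y])).
  by apply: subspace_eq => r x x'; rewrite ?mulrDl ?mulZl tact_linear // mulrDl mulZl.
move=> m /=; move: y.
apply: (TV_ind (P := [set y | _ = tact M << m >> * tact M y])).
  by apply: subspace_eq => r x x'; rewrite ?mulrDr ?mulZr tact_linear // mulrDr mulZr.
by move=> k /=; rewrite monM !tact_mon fmM big_cat.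
Qed.

Lemma word_ind (P : word -> Prop) :
  P 1%M -> (forall i m, P m -> P (fmu i * m)%M) -> forall m, P m.
Proof.
move=> P1 PM [s]; elim: s => [|i s IHs]; last first.
  by rewrite (_ : FMonom _ = fmu i * FMonom s)%M; [apply: PM | apply: word_inj; rewrite fmM fmU].
by rewrite (_ : FMonom _ = 1%M) //; apply: word_inj; rewrite fm1.
Qed.

Lemma TV_morph_eq (f g : TV -> TV) : linear f -> linear g ->
  (forall x y, f (x * y) = f x * f y) -> (forall x y, g (x * y) = g x * g y) ->
  f 1 = g 1 -> (forall i, f << fmu i >> = g << fmu i >>) -> f =1 g.
Proof.
move=> fL gL fM gM fg1 fgU; apply: (TV_ind (P := [set x | f x = g x])).
  exact: subspace_eq.
elim/word_ind => [|i m /= IH] //=.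
by rewrite -monM fM gM fgU IH.
Qed.

Lemma tact_id : tact (1%:M : 'M[rat]_d) =1 id.
Proof.
apply: TV_morph_eq => //; [exact: tact_linear | exact: tactM | exact: tact1 |].
move=> j; rewrite tact_fmu (bigD1 j) //= mxE eqxx scale1r big1 ?addr0 // => i.
by rewrite mxE => /negPf ->; rewrite scale0r.
Qed.

Lemma tact_mulmx (M N : 'M[rat]_d) x : tact (M *m N) x = tact M (tact N x).
Proof.
move: x; apply: (TV_morph_eq (g := fun x => tact M (tact N x))).
- exact: tact_linear.
- by move=> r x y; rewrite !tact_linear.
- exact: tactM.
- by move=> x y; rewrite !tactM.
- by rewrite !tact1.
move=> j; rewrite !tact_fmu (linear_fun_sum _ _ _ (tact_linear M)).
under [RHS]eq_bigr do rewrite tact_fmu scaler_sumr.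
rewrite exchange_big; apply: eq_bigr => i _; rewrite mxE scaler_suml.
by apply: eq_bigr => k _; rewrite scalerA mulrC.
Qed.

Lemma tact_tpow (M : 'M[rat]_d) n x : tpow d n x -> tpow d n (tact M x).
Proof.
move: x; apply: tpow_ind.
  exact: subspace_preim (tact_linear M) (tpow_subspace d n).
move=> m <- /=; move: m; elim/word_ind => [|i m IH].
  by rewrite fdeg1 [tact _ _]tact1; apply: tpow1.
rewrite -monM tactM fdegM fdegU; apply: tpowM _ IH.
rewrite tact_fmu; apply: subspace_big (tpow_subspace d 1) _ => j _.
by apply: (subspaceZ _ (tpow_subspace d 1)); apply: tpow_mon; rewrite fdegU.
Qed.

Lemma mcoeff_fmu_mul (c : 'I_d -> rat) i y m :
  ((\sum_j c j *: << fmu j >>) * y)@_(fmu i * m)%M = c i * y@_m.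
Proof.
have cT : tpow d (fdeg (fmu i)) (\sum_j c j *: << fmu j >>).
  rewrite fdegU; apply: subspace_big (tpow_subspace d 1) _ => j _.
  by apply: (subspaceZ _ (tpow_subspace d 1)); apply: tpow_mon; rewrite fdegU.
have := mcoeff_mid (fmu i) 1%M ((\sum_j c j *: << fmu j >>) * y) m.
rewrite mulm1 => <-; rewrite mid_mull // mcoeffZ; congr (_ * _).
rewrite raddf_sum /=; under eq_bigr do rewrite mcoeffZ mcoeffU1.
rewrite (bigD1 i) //= eqxx mulr1 big1 ?addr0 // => j /negPf ji.
suff -> : (fmu j == fmu i) = false by rewrite mulr0.
by apply/eqP => /(congr1 (@fmonom_val _)); rewrite !fmU => -[/eqP]; rewrite ji.
Qed.

(** The coefficient of v in [tact M << u >>] is the product of the entries M v_k u_k for words of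
    equal length, and zero otherwise; transposing M therefore exchanges u and v. *)
Lemma mcoeff_tact_tr (M : 'M[rat]_d) u v :
  (tact M^T << u >>)@_v = (tact M << v >>)@_u.
Proof.
move: u v; elim/word_ind => [v|i u IH v].
  rewrite [tact _ << 1%M >>]tact1; have [->|v1] := eqVneq v 1%M.
    by rewrite [tact _ << 1%M >>]tact1.
  rewrite mcoeff1 (negPf v1); apply/esym.
  apply: (tpow_coeff (tact_tpow M (tpow_mon (erefl (fdeg v))))).
  by rewrite fdeg1 eq_sym fdeg_eq0.
move: v; elim/word_ind => [|j v _].
  rewrite [tact _ << 1%M >>]tact1 mcoeff1 fmM_eq1 fm1_eq1 /=.
  apply: (tpow_coeff (tact_tpow M^T (tpow_mon (erefl _)))).
  by rewrite fdeg1 fdegM fdegU.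
by rewrite -!monM !tactM !tact_fmu !mcoeff_fmu_mul IH mxE.
Qed.

Lemma tpairing_tact (M : 'M[rat]_d) x y :
  tpairing (tact M^T x) y = tpairing x (tact M y).
Proof.
move: x; apply: (TV_ind (P := [set x | _ = tpairing x (tact M y)])) => [|u /=].
  apply: (subspace_eq (V := rat^o)) => r x x'; last exact: tpairing_linl.
  by rewrite tact_linear; apply: tpairing_linl.
rewrite tpairing_mon; move: y.
apply: (TV_ind (P := [set y | _ = (tact M y)@_u])) => [|v /=].
  apply: (subspace_eq (V := rat^o)) => r x x'; first exact: tpairing_linr.
  by rewrite tact_linear; apply: mcoeff_linear.
by rewrite tpairing_monr mcoeff_tact_tr.
Qed.

Section Quadratic.
Variable R : set TV.
Hypotheses (sR : subspace R) (R2 : R `<=` tpow d 2).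

Lemma ideal_gen_tact (M : 'M[rat]_d) : (forall x, R x -> R (tact M x)) ->
  forall x, ideal_gen R x -> ideal_gen R (tact M x).
Proof.
move=> RM; apply: ideal_gen_sub => [|x /RM]; last exact: ideal_gen_gen.
split=> [|a x /= Ix].
  exact: subspace_preim (tact_linear M) (ideal_gen_subspace R).
by split; rewrite /preimage /= tactM; [apply: ideal_genMl | apply: ideal_genMr].
Qed.

Lemma koszul_X_tact (M : 'M[rat]_d) n j : (forall x, R x -> R (tact M x)) ->
  forall x, koszul_X R n j x -> koszul_X R n j (tact M x).
Proof.
move=> RM; apply: lspan_sub => [|_ [u [r [v [Tu Rr Tv ->]]]]].
  exact: subspace_preim (tact_linear M) (koszul_X_subspace R n j).
rewrite /preimage /= tactM tactM.
by apply: koszul_X_mul; [exact: tact_tpow | exact: RM | exact: tact_tpow].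
Qed.

Lemma koszul_num_stable (M : 'M[rat]_d) n i : (forall x, R x -> R (tact M x)) ->
  stable_subspace (tact M) (koszul_num R n i).
Proof.
move=> RM; split=> [|x]; first exact: koszul_num_subspace.
rewrite /koszul_num; case: ifP => _ /=.
  by move=> ->; rewrite (linear_fun0 (tact_linear M)).
move=> [Tx Xx]; split=> [|j ji]; first exact: tact_tpow.
exact: koszul_X_tact RM _ (Xx j ji).
Qed.

Lemma koszul_den_stable (M : 'M[rat]_d) n i : (forall x, R x -> R (tact M x)) ->
  stable_subspace (tact M) (koszul_den R n i).
Proof.
move=> RM; split=> [|x]; first exact: koszul_den_subspace.
have [le_in|lt_ni] := leqP i n.+1; last first.
  by rewrite /koszul_den leqNgt lt_ni; apply: tact_tpow.
move: x; apply: (koszul_den_ind le_in) => [|j u r v ji Tu Rr Tv].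
  exact: subspace_preim (tact_linear M) (koszul_den_subspace R n i).
rewrite /preimage /= tactM tactM; apply: (koszul_den_gen le_in ji).
by apply: koszul_X_mul; [exact: tact_tpow | exact: RM | exact: tact_tpow].
Qed.

Lemma koszul_den_mul (p m : nat) x (k : TV) : ideal_gen R x -> tpow d p x -> tpow d m k ->
  koszul_den R (p + m) p.+1 (x * k).
Proof.
move=> Ix Tx Tk; apply/(koszul_denP R2); split=> [|b bm]; first exact: tpowM.
rewrite mid_mulr ?bm //; exact: subspaceZ (ideal_gen_subspace R) Ix.
Qed.

(** Completing k to a basis of the whole tensor power makes its coordinates functionals on that
    space, which the pairing represents. They serve to isolate single coefficients in
    [koszul_term_fbasis]. *)
Lemma fbasis_tpow_dual (m : nat) (K : set TV) (J : finType) (k : J -> TV) :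
  subspace K -> K `<=` tpow d m -> fbasis K [set 0] k ->
  exists z : J -> TV, forall i j, tpairing (k j) (z i) = (i == j)%:R.
Proof.
move=> sK KT kP; have sT := tpow_subspace d m.
have [I [b bP]] := fbasis_ex (@fingen_tpow d m) (@subset_refl _ (tpow d m)) sK.
have K0 : [set 0] `<=` K by move=> x ->; case: sK.
have kP' : fbasis (tpow d m `&` K) [set 0] k by rewrite (setIidr KT).
have cP := fbasis_cat sK K0 sT bP kP'.
have [z [_ zE _]] := dual_family sT (@tpairing_repr d m) (subspace0 _) cP.
exists (fun j => z (inr j)) => i j; exact: (zE (inr i) (inr j)).
Qed.

Lemma koszul_term_fbasis (p m : nat) (I J : finType) (al : I -> TV) (ka : J -> TV) :
  fbasis (tpow d p) (ideal_gen R) al -> fbasis (koszul_num R m 1) [set 0] ka ->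
  fbasis (koszul_num R (p + m) p.+1) (koszul_den R (p + m) p.+1)
    (fun s : I * J => al s.1 * ka s.2).
Proof.
move=> [Tal gal ial] kaP; have [Kka gka ika] := kaP.
have Tka j : tpow d m (ka j) by apply: koszul_num_tpow (Kka j).
split=> [[i j] /=|x /(koszul_numP sR R2)[Tx Kx]|c].
- apply/(koszul_numP sR R2); split=> [|a ap]; first exact: tpowM.
  by rewrite mid_mull ?ap //; apply: subspaceZ (koszul_num_subspace R m 1) (Kka j).
(* The left slices of x lie in K_m. Expanding them in [ka] and collecting words writes x as a sum of
   [y j * ka j] with [y j] of degree p, which is then reduced modulo the ideal. *)
- have /choice[c cP] : forall s : p.-tuple 'I_d, exists c : J -> rat,
      mid (words s) 1%M x = \sum_j c j *: ka j.
    move=> s; have [|c c0] := gka (mid (words s) 1%M x).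
      by apply: Kx; rewrite fdeg_words.
    by exists c; apply/eqP; rewrite -subr_eq0; apply/eqP.
  pose y j : TV := \sum_s c s j *: << words s >>.
  have Ty j : tpow d p (y j).
    apply: subspace_sum (tpow_subspace d p) _ => s.
    by apply: tpow_mon; rewrite fdeg_words.
  have xE : x = \sum_j y j * ka j.
    rewrite (mid_decompl (leq_addr m p) Tx).
    under eq_bigr do rewrite cP mulr_sumr.
    rewrite exchange_big; apply: eq_bigr => j _; rewrite mulr_suml.
    by apply: eq_bigr => s _; rewrite mulZl mulZr.
  have /choice[e eP] := fun j => gal _ (Ty j).
  exists (fun s => e s.2 s.1).
  have -> : x - \sum_(s : I * J) e s.2 s.1 *: (al s.1 * ka s.2) =
      \sum_j (y j - \sum_i e j i *: al i) * ka j.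
    under [RHS]eq_bigr do rewrite mulrBl [X in _ - X]mulr_suml.
    rewrite [RHS]sumrB -xE; congr (_ - _); rewrite [RHS]exchange_big [RHS]pair_big.
    by apply: eq_bigr => s _; rewrite mulZl.
  apply: subspace_big (koszul_den_subspace R _ _) _ => j _.
  apply: koszul_den_mul => //; apply: subspaceB (tpow_subspace d p) (Ty j) _.
  exact: subspace_sum (tpow_subspace d p) _.
- move=> /(koszul_denP R2)[_ Ic].
  have [z zP] := fbasis_tpow_dual (koszul_num_subspace R m 1)
    (@koszul_num_tpow d R m 1) kaP.
  pose y j : TV := \sum_i c (i, j) *: al i.
  have cE : \sum_s c s *: (al s.1 * ka s.2) = \sum_j y j * ka j.
    under [RHS]eq_bigr do rewrite mulr_suml.
    rewrite [RHS]exchange_big [RHS]pair_big.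
    by apply: eq_bigr => -[i j] _; rewrite mulZl.
  have Iy (t : m.-tuple 'I_d) : ideal_gen R (\sum_j (ka j)@_(words t) *: y j).
    have := Ic (words t) (fdeg_words t); rewrite cE.
    rewrite (big_morph _ (linear_funD (mid_linear 1%M (words t))) (linear_fun0 (mid_linear 1%M (words t)))).
    by under eq_bigr do rewrite mid_mulr ?fdeg_words //.
  (* Right slices only yield mixtures of the [y j]; weighting them by the coefficients of the dual
     vector [z j] isolates one of them. *)
  have Iyj j : ideal_gen R (y j).
    suff -> : y j = \sum_(t : m.-tuple 'I_d)
        (z j)@_(words t) *: \sum_l (ka l)@_(words t) *: y l.
      exact: subspace_sum (ideal_gen_subspace R) _.
    have zyE l : \sum_(t : m.-tuple 'I_d)
        (z j)@_(words t) *: ((ka l)@_(words t) *: y l) = (j == l)%:R *: y l.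
      rewrite -zP (tpairing_words _ (Tka l)) scaler_suml.
      by apply: eq_bigr => t _; rewrite scalerA mulrC.
    under eq_bigr do rewrite scaler_sumr.
    rewrite exchange_big; under eq_bigr do rewrite zyE.
    rewrite (bigD1 j) //= eqxx scale1r big1 ?addr0 // => l.
    by rewrite eq_sym => /negPf ->; rewrite scale0r.
  by move=> [i j]; apply: (ial (fun i => c (i, j))); apply: Iyj.
Qed.

End Quadratic.
End DiagonalAction.

(** * Traces on the Koszul complex *)

(* The only use of rationality: the character values are real. *)
Lemma mxtrace_rat_repr_inv (gT : finGroupType) (G : {group gT}) n
    (rG : mx_representation rat G n) (g : gT) :
  g \in G -> \tr (rG g^-1%g) = \tr (rG g).
Proof.
move=> Gg; apply: (fmorph_inj (ratr : rat -> algC)).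
have trE h : h \in G -> cfRepr (map_repr (ratr : rat -> algC) rG) h = ratr (\tr (rG h)).
  by move=> Gh; rewrite cfunE Gh map_reprE trace_map_mx.
have := char_inv g (cfRepr_char (map_repr (ratr : rat -> algC) rG)).
by rewrite !trE ?groupV //= => ->; rewrite conj_Crat // Crat_rat.
Qed.

Lemma sum_unit (V : nmodType) (f : unit -> V) : \sum_i f i = f tt.
Proof. by rewrite (big_pred1 tt) // => -[]. Qed.

Section KoszulTraces.
Variable d : nat.
Local Notation TV := (TV d).
Implicit Types (x y z : TV) (R I : set TV).

Section Quadratic.
Variable R : set TV.
Hypotheses (sR : subspace R) (R2 : R `<=` tpow d 2).

Lemma ideal_gen_stable (M : 'M[rat]_d) : (forall x, R x -> R (tact M x)) ->
  stable_subspace (tact M) (ideal_gen R).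
Proof.
by move=> RM; split; [exact: ideal_gen_subspace | apply: ideal_gen_tact].
Qed.

(** On the product basis the action is the Kronecker product of the two matrices, so its trace
    factors. *)
Lemma koszul_term_trace (M : 'M[rat]_d) (p m : nat) :
  (forall x, R x -> R (tact M x)) ->
  quo_trace (tact M) (koszul_num R (p + m) p.+1) (koszul_den R (p + m) p.+1) =
  quo_trace (tact M) (tpow d p) (ideal_gen R) *
  quo_trace (tact M) (koszul_num R m 1) [set 0].
Proof.
move=> RM; have tL := tact_linear M.
have sT n := tpow_subspace d n; have sI := ideal_gen_subspace R.
have sK := koszul_num_subspace R m 1.
have [k [al alP]] := fbasis_ex (@fingen_tpow d p) (@subset_refl _ (tpow d p)) sI.
have [l [ka kaP]] := fbasis_ex (@fingen_tpow d m) (@koszul_num_tpow d R m 1) (subspace0 _).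
have [A AP] := fbasis_mx_ex (@tact_tpow d M p) alP.
have [_ Kstab] := koszul_num_stable m 1 RM.
have [B BP] := fbasis_mx_ex Kstab kaP.
have [_ Istab] := ideal_gen_stable RM.
have [_ Dstab] := koszul_den_stable (p + m) p.+1 RM.
rewrite (quo_trace_fin (sT p) sI tL _ alP AP); last by move=> x _ /Istab.
rewrite (quo_trace_fin sK (subspace0 _) tL _ kaP BP); last first.
  by move=> x _ ->; rewrite (linear_fun0 tL).
rewrite (quo_trace_fin (M := fun s t => A s.1 t.1 * B s.2 t.2)
  (koszul_num_subspace R _ _) (koszul_den_subspace R _ _) tL _
  (koszul_term_fbasis sR R2 alP kaP)); last first.
- move=> [j j'] /=; rewrite tactM.
  (* In K_m the expansion is an equality rather than a congruence, so the only error comes from the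
     A^p factor and lies in <R>_p tensor V^m. *)
  have -> : tact M (ka j') = \sum_i B i j' *: ka i.
    by apply/eqP; rewrite -subr_eq0; apply/eqP; apply: BP.
  have -> : \sum_(s : 'I_k * 'I_l) (A s.1 j * B s.2 j') *: (al s.1 * ka s.2) =
      (\sum_i A i j *: al i) * \sum_i B i j' *: ka i.
    rewrite mulr_suml; under [RHS]eq_bigr do rewrite mulr_sumr.
    rewrite [RHS]pair_big; apply: eq_bigr => s _.
    by rewrite mulZl mulZr scalerA.
  have [Tal _ _] := alP; have [Kka _ _] := kaP.
  rewrite -mulrBl; apply: koszul_den_mul => //.
    apply: subspaceB (sT p) (tact_tpow M (Tal j)) _.
    exact: subspace_sum (sT p) Tal.
  apply: subspace_sum (sT m) _ => i; exact: koszul_num_tpow (Kka i).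
- by move=> x _; apply: Dstab.
rewrite big_distrl /=; under [RHS]eq_bigr do rewrite big_distrr.
by rewrite [RHS]pair_big.
Qed.

Lemma annihilator_subspace : subspace (annihilator R).
Proof.
split=> [|a f g [Tf fR] [Tg gR]].
  split=> [|x _]; first by case: (tpow_subspace d 2).
  by rewrite tpairingC /tpairing big1 // => m _; rewrite mcoeff0 mulr0.
split; first by case: (tpow_subspace d 2) => _; apply.
by move=> x Rx; rewrite tpairing_linl fR // gR // mulr0 addr0.
Qed.

Lemma annihilator_tpow : annihilator R `<=` tpow d 2.
Proof. by move=> f []. Qed.

Lemma annihilator_perp x : tpow d 2 x ->
  (forall f, annihilator R f -> tpairing f x = 0) -> R x.
Proof.
move=> Tx fx0.
apply: (perp_perp (B := @tpairing d) (@fingen_tpow d 2) (tpow_subspace d 2)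
  (@tpairing_repr d 2) sR Tx) => f [Tf Rf].
rewrite tpairingC; apply: fx0; split=> // y Ry; rewrite tpairingC.
by apply: Rf => //; apply: R2.
Qed.

(** Pairing z with a f b, for words a and b and f in R^perp, is pairing f with a slice of z. One
    inclusion holds since slices of K_m lie in R; the other since a slice killed by R^perp lies in
    the double annihilator of R, which is R. *)
Lemma koszul_num_perp m :
  koszul_num R m 1 = perp (tpow d m) (@tpairing d) (ideal_gen (annihilator R)).
Proof.
have sA := annihilator_subspace; have A2 := annihilator_tpow.
apply/seteqP; split=> [z|z [Tz zP]]; rewrite /koszul_num /=.
  move=> [Tz Xz]; split=> // w Tw Iw.
  have := ideal_gen_den A2 Tw Iw; move: w {Tw Iw}.
  have zL : linear (fun w : TV => tpairing w z : rat^o).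
    by move=> a x y; apply: tpairing_linl.
  apply: (koszul_den_ind (P := [set w | tpairing w z = 0]) (leqnn _)).
    exact: subspace_preim zL (subspace0 _).
  move=> j u f v jm Tu [Tf fR] Tv /=.
  move: u Tu.
  have uL : linear (fun u : TV => tpairing (u * f * v) z : rat^o).
    by move=> a x y; rewrite mulrDl mulrDl !mulZl; apply: zL.
  apply: (tpow_ind (subspace_preim uL (subspace0 _))) => a ap.
  rewrite /preimage /=.
  move: v Tv {uL}.
  have vL : linear (fun v : TV => tpairing (<< a >> * f * v) z : rat^o).
    by move=> r x y; rewrite mulrDr mulZr; apply: zL.
  apply: (tpow_ind (subspace_preim vL (subspace0 _))) => b bp.
  rewrite /preimage /= tpairing_mid; apply: fR.
  have jm' : (1 <= j < m)%N by lia.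
  by have /(koszul_XP sR R2) := Xz j jm'; case/(_ jm') => _; apply.
split=> // j /= jm; apply/(koszul_XP sR R2) => //; split=> // a b aE bE.
have mE : m = (fdeg a + 2 + fdeg b)%N by lia.
apply: annihilator_perp => [|f Af]; first by apply: tpow_mid; rewrite -mE.
rewrite -tpairing_mid; apply: zP.
  rewrite mE; apply: tpowM; last exact: tpow_mon.
  by apply: tpowM; [exact: tpow_mon | exact: A2].
by apply: ideal_genMr; apply: ideal_genMl; apply: ideal_gen_gen.
Qed.

Lemma quadratic_dual_trace (M : 'M[rat]_d) m :
  (forall f, annihilator R f -> annihilator R (tact M^T f)) ->
  quo_trace (tact M^T) (tpow d m) (ideal_gen (annihilator R)) =
  quo_trace (tact M) (koszul_num R m 1) [set 0].
Proof.
move=> AM; rewrite koszul_num_perp.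
apply: (quo_trace_perp (@fingen_tpow d m) (tpow_subspace d m)
  (@tpairing_linl d) (@tpairing_linr d) (@tpairing_repr d m) (@tpairing_nondeg d m)).
- exact: tact_linear.
- exact: tact_linear.
- exact: tact_tpow.
- exact: tact_tpow.
- by split; [exact: ideal_gen_subspace | apply: ideal_gen_tact].
- by move=> x y _ _; apply: tpairing_tact.
Qed.

Lemma quo_trace_tpow0 (M : 'M[rat]_d) : (forall x, R x -> R (tact M x)) ->
  quo_trace (tact M) (tpow d 0) (ideal_gen R) = 1.
Proof.
move=> RM; have sI := ideal_gen_subspace R; have [I0 _] := sI.
have bP : fbasis (tpow d 0) (ideal_gen R) (fun _ : unit => 1 : TV).
  split=> [_|x Tx|c]; first exact: tpow1.
    exists (fun=> x@_(@mone _)); rewrite sum_unit.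
    suff -> : x - x@_(@mone _) *: 1 = 0 by [].
    rewrite {1}(tpow_sum Tx) sum_tuple0 words0; exact: subrr.
  rewrite sum_unit => Ic [].
  have T1 : tpow d 0 (c tt *: (1 : TV)).
    exact: (subspaceZ _ (tpow_subspace d 0) (@tpow1 d)).
  (* The ideal meets degree 0 trivially: [koszul_den R 0 1] is an empty sum, as no j satisfies 1 <=
     j <= 1 - 2 with truncated subtraction. *)
  have := ideal_gen_den R2 T1 Ic.
  have s0 : subspace [set 0 : TV] by apply: subspace0.
  move/(koszul_den_ind (leqnn _) s0 _).
  have no j (u r v : TV) : (1 <= j <= 1 - 2)%N -> tpow d (j - 1) u -> R r ->
     tpow d (0 - 1 - j) v -> [set 0] (u * r * v) by lia.
  move=> /(_ no) /= /(congr1 (mcoeff (@mone _))).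
  by rewrite mcoeffZ mcoeff1 eqxx mulr1 mcoeff0.
have [_ Istab] := ideal_gen_stable RM.
rewrite (quo_trace_fin (M := fun _ _ => 1) (tpow_subspace d 0) sI (tact_linear M) _ bP).
- by rewrite sum_unit.
- by move=> x _ /Istab.
by move=> j; rewrite tact1 sum_unit scale1r subrr.
Qed.

Lemma koszul_den_mono n i : koszul_den R n i `<=` koszul_den R n i.+1.
Proof.
have [lt_in|le_ni] := leqP i.+1 n.+1; last first.
  by rewrite {2}/koszul_den leqNgt le_ni; apply: koszul_den_tpow.
apply: (koszul_den_ind (ltnW lt_in) (koszul_den_subspace R n i.+1)).
move=> j u r v ji Tu Rr Tv; apply: (koszul_den_gen (j := j) lt_in); first lia.
exact: koszul_X_mul.
Qed.

Lemma koszul_num_mono n i : koszul_num R n i `<=` koszul_num R n i.+1.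
Proof.
move=> x; case: i => [|i]; last first.
  rewrite /koszul_num /= => -[Tx Xx]; split=> // j /= ij; apply: Xx => /=.
  by move: ij => /andP[/ltnW -> ->].
by rewrite {1}/koszul_num /= => ->; case: (koszul_num_subspace R n 1).
Qed.

(* [koszul] starts at n = 2; in degree 1 the complex is 0 -> V -> V -> 0. *)
Lemma koszul_exact n i : koszul R -> (1 <= n)%N -> (1 <= i <= n.+1)%N ->
  subquo_exact (koszul_num R n i.-1) (koszul_num R n i)
               (koszul_den R n i) (koszul_den R n i.+1).
Proof.
move=> kR; rewrite leq_eqVlt => /orP[/eqP <-|]; last exact: kR.
case: i => [//|[|[|//]]] _ x Nx /=.
  have D12 : koszul_den R 1 1 = koszul_den R 1 2 by [].
  rewrite {1}/koszul_num /= -D12; split=> [Dx|[_ -> ]]; last by rewrite subr0.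
  by exists 0; rewrite ?subr0.
have Tx : tpow d 1 x by apply: koszul_num_tpow Nx.
split=> [_|_]; last by rewrite /koszul_den.
exists x; first by rewrite /koszul_num /=; split=> // j /= j1; lia.
by rewrite subrr; case: (koszul_den_subspace R 1 2).
Qed.

Lemma koszul_euler (M : 'M[rat]_d) n : (forall x, R x -> R (tact M x)) ->
  koszul R -> (1 <= n)%N ->
  \sum_(i < n.+1) (-1) ^+ i *
    (quo_trace (tact M) (tpow d i) (ideal_gen R) *
     quo_trace (tact M) (koszul_num R (n - i) 1) [set 0]) = 0.
Proof.
move=> RM kR n1.
apply: etrans (quo_trace_euler (N := koszul_num R n) (D := koszul_den R n)
  (n := n) (@fingen_tpow d n) (tact_linear M) _ _ _ _ _ _ _ _).
- apply: eq_bigr => i _; rewrite -koszul_term_trace // subnKC //.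
  by rewrite -ltnS.
- exact: koszul_num_tpow.
- by move=> i; apply: koszul_num_stable.
- by move=> i; apply: koszul_den_stable.
- by move=> i _; apply: koszul_num_mono.
- by move=> i; apply: koszul_den_mono.
- by move=> i; apply: koszul_exact.
- by move=> x.
- by move=> x /koszul_num_tpow; rewrite /koszul_den ltnn.
Qed.

End Quadratic.
End KoszulTraces.

(** * Representations of G on A, on its quadratic dual and on K_n *)

Section Representation.
Variables (gT : finGroupType) (G : {group gT}) (d : nat).

Lemma submodule2_graded_repr (rV : mx_representation rat G d) R :
  submodule2 rV R -> graded_repr rV R.
Proof.
move=> [sR R2 RG] n; have [I0 _] := ideal_gen_subspace R.
split=> [g Gg|x _|g h x Gg Gh _].
- split; [exact: tact_linear | exact: tact_tpow |].
  by move=> x _; apply: ideal_gen_tact => y; apply: RG.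
- by rewrite repr_mx1 tact_id subrr.
by rewrite repr_mxM // tact_mulmx subrr.
Qed.

Lemma submodule2_annihilator (rV : mx_representation rat G d) R :
  submodule2 rV R -> submodule2 (dual_repr rV) (annihilator R).
Proof.
move=> [sR R2 RG]; split=> [||g f Gg [Tf fR]].
- exact: annihilator_subspace.
- exact: annihilator_tpow.
split=> [|x Rx]; first exact: tact_tpow.
by rewrite tpairing_tact fR //; apply: RG => //; rewrite groupV.
Qed.

(** In a basis of K the group acts by rational matrices that form a representation, so
    [mxtrace_rat_repr_inv] applies. *)
Lemma quo_trace_inv (rV : mx_representation rat G d) n (K : set (TV d)) s :
  subspace K -> K `<=` tpow d n ->
  (forall g x, g \in G -> K x -> K (tact (rV g) x)) -> s \in G ->
  quo_trace (tact (rV s^-1%g)) K [set 0] = quo_trace (tact (rV s)) K [set 0].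
Proof.
move=> sK KT KG Gs.
have s0 : subspace [set 0 : TV d] by apply: subspace0.
have [k [b bP]] := fbasis_ex (@fingen_tpow d n) KT s0.
have /choice[M MP] : forall g, exists M : 'M[rat]_k, g \in G ->
    forall j, [set 0] (tact (rV g) (b j) - colcomb b M j).
  (* Zero is a filler: a matrix is chosen for every element of [gT] but constrained only on G. *)
  move=> g; have [Gg|nGg] := boolP (g \in G); last by exists 0.
  have [A AP] := fbasis_mx_ex (KG g ^~ Gg) bP.
  exists (\matrix_(i, j) A i j) => _ j; rewrite /colcomb.
  by under eq_bigr do rewrite mxE; apply: AP.
have M_repr : mx_repr G M.
  split=> [|g h Gg Gh].
    apply: (colcomb_inj s0 (U := K) (b := b) (z := b) bP).
      by move=> j; have := MP 1%g (group1 G) j; rewrite repr_mx1 tact_id.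
    exact: colcomb1.
  apply: (colcomb_inj s0 (U := K) (b := b) (z := fun j => tact (rV (g * h)%g) (b j)) bP).
    by apply: MP; apply: groupM.
  move=> j; apply: (colcomb_trans s0 (y := fun i => tact (rV g) (b i))); last exact: MP.
  have <- : tact (rV g) (colcomb b (M h) j) = colcomb (fun i => tact (rV g) (b i)) (M h) j.
    by rewrite /colcomb (linear_fun_sum _ _ _ (tact_linear _)).
  rewrite repr_mxM // tact_mulmx -(linear_funB _ _ (tact_linear _)).
  by have /= -> := MP h Gh j; rewrite (linear_fun0 (tact_linear _)).
have trE g : g \in G -> quo_trace (tact (rV g)) K [set 0] = \tr (M g).
  move=> Gg; apply: (quo_traceE sK s0 (tact_linear _) _ bP (MP g Gg)).
  by move=> x _ ->; rewrite /= (linear_fun0 (tact_linear _)).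
have Gs1 : s^-1%g \in G by rewrite groupV.
apply: etrans (trE _ Gs1) (etrans _ (esym (trE _ Gs))).
exact: (mxtrace_rat_repr_inv (MxRepresentation M_repr) Gs).
Qed.

Lemma graded_char_dual (rV : mx_representation rat G d) R s n :
  submodule2 rV R -> s \in G ->
  graded_char (dual_repr rV) (annihilator R) s n =
  quo_trace (tact (rV s)) (koszul_num R n 1) [set 0].
Proof.
move=> sub Gs; have [sR R2 RG] := sub; have [_ _ AG] := submodule2_annihilator sub.
rewrite -(quo_trace_inv (n := n) (koszul_num_subspace R n 1) (@koszul_num_tpow d R n 1) _ Gs).
  (* [dual_repr rV s] unfolds to the transpose of [rV s^-1], so the matrix M here is that of
     s^-1. *)
  by apply: quadratic_dual_trace => // f; apply: AG.
move=> g x Gg; have [_] := koszul_num_stable n 1 (fun x => RG g x Gg).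
exact.
Qed.

End Representation.

Theorem theorem16 (gT : finGroupType) (G : {group gT}) (d : nat)
    (rV : mx_representation rat G d) (R : set (TV d)) :
  submodule2 rV R -> koszul R ->
  [/\ graded_repr rV R,
      graded_repr (dual_repr rV) (annihilator R)
    & forall s : gT, s \in G ->
        series_mul (graded_char rV R s)
          (series_opp_var (graded_char (dual_repr rV) (annihilator R) s))
        = series_one].
Proof.
move=> sub kR; have subA := submodule2_annihilator sub.
split=> [||s Gs]; try exact: submodule2_graded_repr.
have [sR R2 RG] := sub; have [sA A2 AG] := subA.
have Rs x : R x -> R (tact (rV s) x) by apply: RG.
apply/funext=> n; rewrite /series_mul /series_opp_var /series_one.
(* The Euler relation needs degree at least 1. The constant coefficient is 1 * 1, both algebras
   being the base field in degree 0. *)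
case: n => [|n].
  rewrite big_ord1 expr0 mul1r [graded_char rV R s 0]quo_trace_tpow0 //.
  by rewrite [graded_char _ _ _ _]quo_trace_tpow0 ?mul1r // => f; apply: AG.
(* The product of series carries the sign (-1)^(n+1-i) from A^!(-z), the complex the sign (-1)^i;
   they differ by the overall factor (-1)^(n+1). *)
rewrite /=; transitivity ((-1) ^+ n.+1 * \sum_(i < n.+2) (-1) ^+ i *
    (quo_trace (tact (rV s)) (tpow d i) (ideal_gen R) *
     quo_trace (tact (rV s)) (koszul_num R (n.+1 - i) 1) [set 0])); last first.
  by rewrite koszul_euler // mulr0.
rewrite mulr_sumr; apply: eq_bigr => i _.
rewrite (graded_char_dual _ sub Gs) mulrCA !mulrA; congr (_ * _ * _).
have signB k l : (l <= k)%N -> (-1) ^+ (k - l) = (-1) ^+ k * (-1) ^+ l :> rat.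
  move=> le_lk; rewrite -{2}(subnK le_lk) exprD -mulrA -exprD addnn.
  by rewrite -mul2n exprM sqrrN !expr1n mulr1.
by apply: signB; rewrite -ltnS.
Qed.
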